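(* Let $V:\mathbb{R}^d\to\mathbb{R}$ be smooth and suppose $\pi=e^{-V}$ is a probability density on $\mathbb{R}^d$ satisfying the Poincaré inequality with constant $\lambda>0$. Let $p>1$, $\beta>0$ with $p+\beta\geq2$, let $R,T>0$ and small $\epsilon_2>0$. Let $\varsigma_R\in\mathcal{C}^\infty(B_R(0))$ with $\|\varsigma_R\|_{L^1(B_R(0),\pi)}=1$, $\varsigma_R(x)\in(0,1/\epsilon_2]$ for $x\in B_R(0)$ and $\varsigma_R(x)=0$ for $x\in\partial B_R(0)$, and let $\mu$ be the classical solution of \[ \partial_t\mu=\frac{1}{1+\beta}\Big[\Delta\mu^{\beta+1}-\langle\nabla V,\nabla\mu^{\beta+1}\rangle\Big]\ \text{in }B_R(0)\times(0,T],\quad \mu(x,0)=\varsigma_R(x),\quad \mu=0 \text{ on }\partial B_R(0)\times[0,T]. \] Then $t\mapsto K_p(\mu(t))$ is non-increasing. Furthermore, as long as $\|\mu(t)\|_{L^p(B_R(0),\pi)}\geq1$, \[ K_p(\mu(t))\leq\begin{cases}-\dfrac{p\log\Big(e^{-\frac{\beta(p-1)}{p}K_p(\varsigma_R)}+\frac{2\beta\lambda(p-1)}{(p+\beta)^2}t\Big)}{\beta(p-1)}, & 0<t<t_0,\\[2mm] e^{-\frac{2p\lambda(t-t_0)}{(p+\beta)^2}}K_p(\mu(t_0)), & t\geq t_0,\end{cases} \] where $K_p(f):=(p-1)^{-1}\log\big(\int_{B_R(0)}f^p\,d\pi\big)$ and $t_0:=\inf\{t\in[0,\infty):K_p(\m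u(t))\leq1\}$.
   Context: $L^p(B_R(0),\pi)$ denotes $L^p$ on $B_R(0)$ with respect to the measure $\pi(x)\,dx$. The Poincaré inequality with constant $\lambda>0$ means: for all $u\in H^1(\mathbb{R}^d)$, $\int u^2\,d\pi-(\int u\,d\pi)^2\leq \lambda^{-1}\int\|\nabla u\|^2\,d\pi$. *)

(* Defs.v *)
From HB Require Import structures.
From mathcomp Require Import all_boot all_order all_algebra.
From mathcomp Require Import all_classical all_reals all_analysis.
Set Implicit Arguments. Unset Strict Implicit. Unset Printing Implicit Defensive.
Import Order.TTheory GRing.Theory Num.Theory.
Import numFieldNormedType.Exports.
Local Open Scope classical_set_scope.
Local Open Scope ring_scope.

Section Defs.
Variable R : realType.

Definition enorm (d : nat) (x : 'rV[R]_d) : R := Num.sqrt (\sum_(i < d) x 0 i ^+ 2).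

Definition oball (d : nat) (r : R) : set 'rV[R]_d := [set x | enorm x < r].
Definition cball (d : nat) (r : R) : set 'rV[R]_d := [set x | enorm x <= r].
Definition sphere (d : nat) (r : R) : set 'rV[R]_d := [set x | enorm x = r].

Definition evec (d : nat) (i : 'I_d) : 'rV[R]_d := delta_mx 0 i.

Definition partial (d : nat) (i : 'I_d) (f : 'rV[R]_d -> R) : 'rV[R]_d -> R :=
  fun x => 'D_(evec i) f x.

Definition ipartial (d : nat) (s : seq 'I_d) (f : 'rV[R]_d -> R) : 'rV[R]_d -> R :=
  foldr (fun i g => partial i g) f s.

Definition smooth (d : nat) (f : 'rV[R]_d -> R) : Prop :=
  (forall (s : seq 'I_d) (i : 'I_d) (x : 'rV[R]_d), derivable (ipartial s f) x (evec i)) /\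
  (forall s : seq 'I_d, continuous (ipartial s f)).

Definition smooth_on (d : nat) (A : set 'rV[R]_d) (f : 'rV[R]_d -> R) : Prop :=
  forall (s : seq 'I_d) (x : 'rV[R]_d), A x ->
    (forall i : 'I_d, derivable (ipartial s f) x (evec i)) /\
    {for x, continuous (ipartial s f)}.

Definition laplacian (d : nat) (f : 'rV[R]_d -> R) (x : 'rV[R]_d) : R :=
  \sum_(i < d) partial i (partial i f) x.

Definition grad_dot (d : nat) (f g : 'rV[R]_d -> R) (x : 'rV[R]_d) : R :=
  \sum_(i < d) partial i f x * partial i g x.

Definition grad_sq (d : nat) (f : 'rV[R]_d -> R) (x : 'rV[R]_d) : R :=
  \sum_(i < d) partial i f x ^+ 2.

(* Lebesgue integral over R^d, written out as the iterated one-dimensional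
   Lebesgue integral (Tonelli/Fubini) *)
Fixpoint iint (d : nat) : ('rV[R]_d -> \bar R) -> \bar R :=
  match d with
  | 0 => fun f => f 0
  | d'.+1 => fun f =>
      (\int[@lebesgue_measure R]_x iint (fun y : 'rV[R]_d' =>
          f (row_mx (const_mx x : 'rV[R]_1) y)))%E
  end.

Definition iint_on (d : nat) (A : set 'rV[R]_d) (f : 'rV[R]_d -> \bar R) : \bar R :=
  iint (fun x => if `[< A x >] then f x else 0%E).

Definition dens (d : nat) (V : 'rV[R]_d -> R) (x : 'rV[R]_d) : R := expR (- V x).

Definition pint (d : nat) (V : 'rV[R]_d -> R) (A : set 'rV[R]_d) (f : 'rV[R]_d -> R) : \bar R :=
  iint_on A (fun x => (f x * dens V x)%:E).

(* Poincare inequality with constant lam, for u in H^1(R^d) (here: u of class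
   C^1 with u and |grad u| square-integrable w.r.t. Lebesgue measure) *)
Definition C1 (d : nat) (u : 'rV[R]_d -> R) : Prop :=
  (forall (i : 'I_d) (x : 'rV[R]_d), derivable u x (evec i)) /\
  continuous u /\ (forall i : 'I_d, continuous (partial i u)).

Definition poincare (d : nat) (V : 'rV[R]_d -> R) (lam : R) : Prop :=
  forall u : 'rV[R]_d -> R, C1 u ->
    (iint (fun x => (u x ^+ 2)%R%:E) < +oo)%E ->
    (iint (fun x => (grad_sq u x)%:E) < +oo)%E ->
    (pint V setT (fun x => (u x ^+ 2)%R) - pint V setT u * pint V setT u
       <= (lam^-1)%:E * pint V setT (grad_sq u))%E.

Definition Kp (d : nat) (V : 'rV[R]_d -> R) (r p : R) (f : 'rV[R]_d -> R) : R :=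
  (p - 1)^-1 * ln (fine (pint V (oball r) (fun x => f x `^ p))).

Definition Lpnorm (d : nat) (V : 'rV[R]_d -> R) (r p : R) (f : 'rV[R]_d -> R) : R :=
  (fine (pint V (oball r) (fun x => `|f x| `^ p))) `^ p^-1.

Definition classical_solution (d : nat) (V : 'rV[R]_d -> R) (beta r T : R)
    (vs : 'rV[R]_d -> R) (mu : 'rV[R]_d -> R -> R) : Prop :=
  let w := fun t x => mu x t `^ (beta + 1) in
  (* nonnegative (mu^{beta+1} is taken of a nonnegative density) *)
  (forall x t, cball r x -> 0 <= t <= T -> 0 <= mu x t) /\
  {within [set z : 'rV[R]_d * R | cball r z.1 /\ 0 <= z.2 <= T],
     continuous (fun z => mu z.1 z.2)} /\
  (forall x t, oball r x -> 0 < t < T ->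
     derivable (mu x) t 1 /\
     {for (x, t), continuous (fun z : 'rV[R]_d * R => derive1 (mu z.1) z.2)} /\
     (forall i : 'I_d,
        derivable (w t) x (evec i) /\
        {for (x, t), continuous (fun z : 'rV[R]_d * R => partial i (w z.2) z.1)} /\
        forall j : 'I_d,
          derivable (partial i (w t)) x (evec j) /\
          {for (x, t), continuous
             (fun z : 'rV[R]_d * R => partial j (partial i (w z.2)) z.1)})) /\
  (forall x t, oball r x -> 0 < t < T ->
     derive1 (mu x) t = (1 + beta)^-1 * (laplacian (w t) x - grad_dot V (w t) x)) /\
  (forall x, cball r x -> mu x 0 = vs x) /\
  (forall x t, sphere r x -> 0 <= t <= T -> mu x t = 0).

End Defs.

(* Main.v *)
Require Import Defs.
From HB Require Import structures.
From mathcomp Require Import all_boot all_order all_algebra.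
From mathcomp Require Import all_classical all_reals all_analysis.
From mathcomp Require Import ring lra.
Import Order.TTheory GRing.Theory Num.Theory.
Import numFieldNormedType.Exports.
Local Open Scope classical_set_scope.
Local Open Scope ring_scope.

(** Put [F t = \int_{B_r} mu(t)^p dpi]. Testing the equation against powers of
  [mu] gives [F' = - 4p(p-1)/(p+beta)^2 \int |grad mu^((p+beta)/2)|^2 dpi]; the
  Poincare inequality bounds the integral below by [lam] times the variance of
  [mu^((p+beta)/2)]. Since [\int mu dpi <= 1] and [p + beta >= 2], log-convexity
  of [s |-> \int mu^s dpi] and Jensen's inequality bound that variance below by
  [F^(1 + beta/p) (1 - exp (- K))], and [1 - exp (- K)] is at least [1/2] when
  [K >= 1] and at least [K/2] when [0 <= K <= 1]. The two resulting differential
  inequalities integrate to the two bounds.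

  No regularity of [mu] at the boundary of the ball or where [mu = 0] is
  available, so powers are replaced by C^2 functions vanishing near 0: as [mu] is
  continuous and vanishes on the sphere, their values at [mu] are compactly
  supported in the open ball, uniformly in time, and also are admissible in the
  Poincare inequality. Only integrals of compactly supported continuous
  functions are then needed, and the iterated integral is used through its
  linearity, positivity and boundedness on these. The bound [\int mu dpi <= 1] is
  the limit [p -> 1] of the monotonicity of [F]. Finally [K] is monotone only if
  [F] never vanishes ([ln 0 = 0]); this is proved by testing the equation against
  a compactly supported subsolution. *)

Set Implicit Arguments.
Unset Strict Implicit.

(** * Integration of compactly supported continuous functions *)

Section CompactSupport.
Variable R : realType.

(** The cutoff must leave no error in the dissipation identity, since that identity contains a
    gradient with no a priori control. It therefore enters the second derivative of the truncated
    power of order [p] squared, and the first derivative of the truncated power of order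
    [(p + beta) / 2] once. The relation [phi' s * s ^ beta = c * h' s ^ 2] then holds exactly, and
    errors occur only in quantities without derivatives, where they are at most [e]. The truncated
    moments are differentiable, whereas the moments themselves are only shown to be continuous. Each
    differential inequality is therefore integrated for the truncated moment with an error
    proportional to [e], and [e] tends to 0 only in the integrated inequality. The constant 1 is not
    compactly supported. A plateau function of mass at most 1 replaces it in Jensen's inequality and
    wherever a constant error is integrated. *)

Lemma contM (T : topologicalType) (f g : T -> R) (x : T) :
  continuous_at x f -> continuous_at x g -> continuous_at x (fun y => f y * g y).
Proof. by move=> cf cg; exact: (continuousM cf cg). Qed.

Lemma contD (T : topologicalType) (f g : T -> R) (x : T) :
  continuous_at x f -> continuous_at x g -> continuous_at x (fun y => f y + g y).
Proof. by move=> cf cg; exact: (continuousD cf cg). Qed.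

Lemma cont_cst (T : topologicalType) (a : R) (x : T) : continuous_at x (fun _ : T => a).
Proof. exact: cvg_cst. Qed.

Lemma cont_comp (T U V : topologicalType) (f : T -> U) (g : U -> V) (x : T) :
  continuous_at x f -> continuous_at (f x) g -> continuous_at x (fun y => g (f y)).
Proof. by move=> cf cg; exact: continuous_comp. Qed.

Lemma cont_pair (T U V : topologicalType) (f : T -> U) (g : T -> V) (x : T) :
  continuous_at x f -> continuous_at x g -> continuous_at x (fun y => (f y, g y)).
Proof. by move=> cf cg; exact: cvg_pair. Qed.

Lemma cont_fst (X Y U : topologicalType) (g : X * Y -> U) (x : X) (y : Y) :
  continuous_at (x, y) g -> continuous_at x (fun x' => g (x', y)).
Proof.
move=> cg; apply: (@cont_comp X (X * Y)%type U (fun x' => (x', y)) g x) => //.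
by apply: (@cont_pair X X Y (fun x' => x') (fun=> y) x); [exact: cvg_id|exact: cvg_cst].
Qed.

Lemma rV_cvg (T : Type) (F : set_system T) (d : nat) (f : T -> 'rV[R]_d) (l : 'rV[R]_d) :
  Filter F -> (forall i, f x 0 i @[x --> F] --> l 0 i) -> f x @[x --> F] --> l.
Proof.
move=> FF H; apply/cvg_ballP => e e0.
have : \forall x \near F, forall j, ball (l 0 j) e (f x 0 j).
  by apply: filter_forall => j; by move/cvg_ballP: (H j); apply.
by apply: filterS => x Hx; split => // i j; rewrite ord1.
Qed.

Lemma cvg_coord (T : Type) (F : set_system T) (d : nat) (f : T -> 'rV[R]_d) (l : 'rV[R]_d) i :
  Filter F -> f x @[x --> F] --> l -> f x 0 i @[x --> F] --> l 0 i.
Proof. by move=> FF H; exact: (@cvg_comp _ _ _ f (fun M : 'rV[R]_d => M 0 i) _ _ _ H (@coord_continuous _ _ _ _ _ _)). Qed.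

(** A tube-lemma argument: continuity at the points over [y0] and compactness of [K] give uniformity
    in [x]. This is what lets limits and derivatives pass under the integral below. *)
Lemma unif_cvg (X Y : topologicalType) (K : set X) (g : X -> Y -> R) (y0 : Y) :
  compact K ->
  (forall x, K x -> continuous_at (x, y0) (fun z : X * Y => g z.1 z.2)) ->
  forall e : R, 0 < e -> \forall y \near y0, forall x, K x -> `|g x y - g x y0| < e.
Proof.
move=> /compact_near_coveringP cK cg e e0.
pose P y x := `|g x y - g x y0| < e.
apply: (cK Y (nbhs y0) P) => x Kx.
have e20 : 0 < e / 2 by rewrite divr_gt0.
have /cvgrPdist_lt/(_ _ e20) c1 := cg x Kx.
have c2 : \forall z \near (x, y0), `|g x y0 - g z.1 y0| < e / 2.
  have /cvgrPdist_lt/(_ _ e20) : continuous_at (x, y0) (fun z : X * Y => g z.1 y0).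
    apply: (cont_comp (cont_pair _ _) (cg x Kx)); [exact: cvg_fst|exact: cvg_cst].
  by [].
apply: filterS2 c1 c2 => -[x' y] /= a b.
rewrite /P (le_lt_trans (ler_distD (g x y0) _ _))// (splitr e) ltrD//.
by rewrite distrC.
Qed.

(** The size [A] of the box is a parameter, so that a whole family of functions shares one box and
    [(2 * A) ^+ d] bounds their integrals uniformly. *)
Definition Cc (d : nat) (A : R) (f : 'rV[R]_d -> R) : Prop :=
  continuous f /\ forall x : 'rV[R]_d, (exists i, A < `|x 0 i|) -> f x = 0.

Definition J (d : nat) (f : 'rV[R]_d -> R) : R := fine (iint (EFin \o f)).

Lemma Cc_le d A B (f : 'rV[R]_d -> R) : A <= B -> Cc A f -> Cc B f.
Proof.
move=> AB [cf f0]; split => // x [i xi]; apply: f0; exists i; exact: le_lt_trans xi.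
Qed.

Lemma Cc_lin d A (f g : 'rV[R]_d -> R) a : Cc A f -> Cc A g -> Cc A (fun x => a * f x + g x).
Proof.
move=> [cf f0] [cg g0]; split => [x|x hx]; last by rewrite f0// g0// mulr0 addr0.
exact: contD (contM (@cont_cst _ _ _) (cf x)) (cg x).
Qed.

Definition box (d : nat) (A : R) : set 'rV[R]_d := [set x | forall i, `|x 0 i| <= A].

Lemma box_compact d A : compact (box A : set 'rV[R]_d).
Proof.
rewrite (_ : box A = [set v : 'rV[R]_d | forall i, `[- A, A]%classic (v ord0 i)]).
  apply: (@rV_compact R d (fun=> `[- A, A]%classic)) => i; exact: segment_compact.
by apply/seteqP; split => x /= H i; have := H i; rewrite /= in_itv/= ler_norml.
Qed.

Lemma not_box d A (x : 'rV[R]_d) : ~ box A x -> exists i, A < `|x 0 i|.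
Proof.
move=> /existsNP[i /negP]; rewrite -ltNge => hi; by exists i.
Qed.

Definition cons_rv (d : nat) (x : R) (y : 'rV[R]_d) : 'rV[R]_d.+1 :=
  row_mx (const_mx x : 'rV[R]_1) y.

Lemma cons_rv0 d x (y : 'rV[R]_d) : cons_rv x y 0 0 = x.
Proof.
by rewrite /cons_rv mxE; case: splitP => [j _|k]; rewrite ?mxE.
Qed.

Lemma cons_rvS d x (y : 'rV[R]_d) i : cons_rv x y 0 (lift ord0 i) = y 0 i.
Proof.
by rewrite /cons_rv mxE; case: splitP => j; rewrite /= /bump leq0n; [rewrite ord1|move=> /addnI/val_inj ->].
Qed.

Lemma cvg_cons_rv (T : Type) (F : set_system T) d (f : T -> R) (g : T -> 'rV[R]_d) a b :
  Filter F -> f x @[x --> F] --> a -> g x @[x --> F] --> b ->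
  cons_rv (f x) (g x) @[x --> F] --> cons_rv a b.
Proof.
move=> FF fa gb; apply: rV_cvg => i.
have [->|[j ->]] : i = 0 \/ exists j, i = lift ord0 j.
- by case: (unliftP ord0 i) => [j|] ->; [right; exists j|left].
- by under eq_fun do rewrite cons_rv0; rewrite cons_rv0.
- by under eq_fun do rewrite cons_rvS; rewrite cons_rvS; exact: cvg_coord.
Qed.

Definition slice d (f : 'rV[R]_d.+1 -> R) (x : R) : 'rV[R]_d -> R := fun y => f (cons_rv x y).

Lemma slice_cont d (f : 'rV[R]_d.+1 -> R) : continuous f ->
  continuous (fun z : 'rV[R]_d * R => slice f z.2 z.1).
Proof.
move=> cf -[y x] /=; apply: (@cvg_comp _ _ _ (fun z => cons_rv z.2 z.1) f _ _ _ _ (cf _)).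
by apply: cvg_cons_rv; [exact: cvg_snd|exact: cvg_fst].
Qed.

Lemma slice_Cc d A (f : 'rV[R]_d.+1 -> R) x : Cc A f -> Cc A (slice f x).
Proof.
move=> [cf f0]; split => [y|y [i hi]].
  by apply: (@cont_fst _ _ _ (fun z : 'rV[R]_d * R => slice f z.2 z.1) y x); exact: slice_cont.
by apply: f0; exists (lift ord0 i); rewrite cons_rvS.
Qed.

(** The three properties are proved together by induction on [d]: integrability in the first
    variable comes from continuity of the inner integral, which in turn uses linearity and the bound
    in one dimension less. *)
Definition iint_spec d : Prop := forall A : R, 0 <= A ->
  [/\ forall f : 'rV[R]_d -> R, Cc A f -> iint (EFin \o f) \is a fin_num,
      forall (f g : 'rV[R]_d -> R) a, Cc A f -> Cc A g ->
        J (fun x => a * f x + g x) = a * J f + J g &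
      forall (f : 'rV[R]_d -> R) M, Cc A f -> 0 <= M -> (forall x, f x <= M) ->
        J f <= (2 * A) ^+ d * M].

Lemma J_param_spec d (T : topologicalType) A (F : 'rV[R]_d -> T -> R) t0 : iint_spec d -> 0 <= A ->
  (forall t, Cc A (F ^~ t)) ->
  (forall x, continuous_at (x, t0) (fun z : 'rV[R]_d * T => F z.1 z.2)) ->
  J (F ^~ t) @[t --> t0] --> J (F ^~ t0).
Proof.
move=> /(_ A) H A0 CF cF; have [_ lin bnd] := H A0.
apply/cvgrPdist_le => e e0.
(* The summand 1 keeps [B] positive when [A = 0]. *)
pose B := (2 * A) ^+ d + 1.
have B0 : 0 < B by rewrite ltr_wpDl// exprn_ge0// mulr_ge0.
have U := unif_cvg (@box_compact d A) (fun x _ => cF x) (divr_gt0 e0 B0).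
have key s t : (forall x, box A x -> `|F x s - F x t| <= e / B) -> J (F ^~ s) - J (F ^~ t) <= e.
  move=> h; have -> : J (F ^~ s) - J (F ^~ t) = J (fun x => -1 * F x t + F x s).
    by rewrite lin// mulN1r addrC.
  apply: (@le_trans _ _ ((2 * A) ^+ d * (e / B))).
    apply: bnd; [exact: Cc_lin|by rewrite divr_ge0 ?ltW|move=> x].
    have [bx|/not_box nb] := pselect (box A x).
      by rewrite mulN1r addrC (le_trans (ler_norm _))// h.
    by rewrite (CF s).2// (CF t).2// mulr0 addr0 divr_ge0 ?ltW.
  rewrite mulrCA -[leRHS]mulr1 ler_wpM2l ?ltW// ltr_pdivrMr// mul1r.
  by rewrite /B ltrDl.
apply: filterS U => t h.
have h1 : J (F ^~ t) - J (F ^~ t0) <= e by apply: key => x bx; rewrite ltW// h.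
have h2 : J (F ^~ t0) - J (F ^~ t) <= e by apply: key => x bx; rewrite distrC ltW// h.
by rewrite ler_norml h2 andbT lerNl opprB.
Qed.

Lemma integral_segment (A : R) (G : R -> R) : 0 <= A -> continuous G ->
  (forall x, A < `|x| -> G x = 0) ->
  (\int[@lebesgue_measure R]_x (G x)%:E = \int[@lebesgue_measure R]_(x in `[(- A)%R, A]) (G x)%:E)%E
  /\ (@lebesgue_measure R).-integrable `[- A, A] (EFin \o G).
Proof.
move=> A0 cG G0; split.
  rewrite [RHS]integral_mkcond; apply: eq_integral => x _; rewrite patchE.
  case: ifPn => //; rewrite notin_setE/= in_itv/= => /negP.
  by rewrite -ler_norml -ltNge => /G0 ->.
apply: continuous_compact_integrable; first exact: segment_compact.
by apply: continuous_subspaceT.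
Qed.

Lemma J_slice_spec d A (f : 'rV[R]_d.+1 -> R) : iint_spec d -> 0 <= A -> Cc A f ->
  [/\ iint (EFin \o f) = (\int[@lebesgue_measure R]_(x in `[(- A)%R, A]) (J (slice f x))%:E)%E,
      (@lebesgue_measure R).-integrable `[- A, A] (EFin \o (fun x => J (slice f x))) &
      continuous (fun x => J (slice f x))].
Proof.
move=> IH A0 Cf; have [fin lin bnd] := IH _ A0.
have cG : continuous (fun x => J (slice f x)).
  move=> x; apply: (@J_param_spec d _ A (fun y x => slice f x y)) => // [t|y].
    exact: slice_Cc.
  by apply: slice_cont; case: Cf.
have G0 x : A < `|x| -> J (slice f x) = 0.
  (* Writing the zero function as [- f + f] reduces [J 0 = 0] to linearity. *)
  move=> Ax; have Z : slice f x = fun y => -1 * f (cons_rv x y) + f (cons_rv x y).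
    by apply/funext => y; rewrite mulN1r addNr; apply: Cf.2; exists 0; rewrite cons_rv0.
  by rewrite Z lin ?mulN1r ?addNr//; exact: (slice_Cc x Cf).
have [e i] := integral_segment A0 cG G0.
split => //; rewrite -e /=; apply: eq_integral => x _.
by rewrite /J fineK//; apply: fin; exact: slice_Cc.
Qed.

Lemma iint_specP d : iint_spec d.
Proof.
elim: d => [|d IH] A A0.
  split => [f _|f g a _ _|f M _ _ fM] //=; by rewrite /J/= expr0 mul1r.
have [fin lin bnd] := IH _ A0.
have sl (f : 'rV[R]_d.+1 -> R) (Cf : Cc A f) := J_slice_spec IH A0 Cf.
have mI : measurable (`[- A, A]%classic : set (measurableTypeR R)) by exact: measurable_itv.
have JE (f : 'rV[R]_d.+1 -> R) : Cc A f -> J f = \int[@lebesgue_measure R]_(x in `[- A, A]) J (slice f x).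
  by move=> Cf; have [e _ _] := sl _ Cf; rewrite /J e.
split => [f Cf|f g a Cf Cg|f M Cf M0 fM].
- by have [-> i _] := sl _ Cf; exact: integrable_fin_num.
- rewrite !JE//; last exact: Cc_lin.
  have [_ i1 _] := sl _ Cf; have [_ i2 _] := sl _ Cg.
  rewrite -RintegralZl// -RintegralD//; last first.
    by have := integrableZl mI a i1; apply: eq_integrable.
  apply: eq_Rintegral => x _; rewrite -lin//; exact: slice_Cc.
- rewrite JE//; have [_ i1 _] := sl _ Cf.
  apply: (@le_trans _ _ (\int[@lebesgue_measure R]_(x in `[(- A)%R, A]) ((2 * A) ^+ d * M))).
    apply: le_Rintegral => //.
      apply: continuous_compact_integrable; first exact: segment_compact.
      by apply: continuous_subspaceT => x; exact: cvg_cst.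
    by move=> x _; apply: bnd => // [|y]; [exact: slice_Cc|exact: fM].
  rewrite Rintegral_cst//= lebesgue_measure_itv/= lte_fin.
  case: ifPn => [_|]; last by rewrite -leNgt mulr0 => _; rewrite mulr_ge0 ?exprn_ge0 ?mulr_ge0.
  by rewrite -EFinB/= exprSr opprK mulr2n mulrDl mul1r mulrAC.
Qed.

End CompactSupport.

(** * Positivity, differentiation under the integral, integrals of partial derivatives *)

Section Functional.
Variable R : realType.
Implicit Types A B M : R.

Lemma iint_J d A (f : 'rV[R]_d -> R) : 0 <= A -> Cc A f -> iint (EFin \o f) = (J f)%:E.
Proof. by move=> A0 Cf; have [fin _ _] := @iint_specP R d A A0; rewrite /J fineK// fin. Qed.

Lemma J_lin d A (f g : 'rV[R]_d -> R) a : 0 <= A -> Cc A f -> Cc A g ->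
  J (fun x => a * f x + g x) = a * J f + J g.
Proof. by move=> A0; have [_ lin _] := @iint_specP R d A A0; exact: lin. Qed.

Lemma J_ub d A (f : 'rV[R]_d -> R) M : 0 <= A -> Cc A f -> 0 <= M -> (forall x, f x <= M) ->
  J f <= (2 * A) ^+ d * M.
Proof. by move=> A0; have [_ _ b] := @iint_specP R d A A0; exact: b. Qed.

Lemma Cc0 d A : Cc A (fun _ : 'rV[R]_d => 0).
Proof. by split => // x; exact: cont_cst. Qed.

Lemma J0 d A : 0 <= A -> J (fun _ : 'rV[R]_d => 0) = 0.
Proof.
move=> A0; have := J_lin (-1) A0 (@Cc0 d A) (@Cc0 d A).
by under eq_fun do rewrite mulr0 addr0; rewrite mulN1r addNr.
Qed.

Lemma JZ d A (f : 'rV[R]_d -> R) a : 0 <= A -> Cc A f -> J (fun x => a * f x) = a * J f.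
Proof.
move=> A0 Cf; have := J_lin a A0 Cf (@Cc0 d A).
by under eq_fun do rewrite addr0; rewrite (J0 d A0) addr0.
Qed.

Lemma JD d A (f g : 'rV[R]_d -> R) : 0 <= A -> Cc A f -> Cc A g ->
  J (fun x => f x + g x) = J f + J g.
Proof.
move=> A0 Cf Cg; have := J_lin 1 A0 Cf Cg.
by under eq_fun do rewrite mul1r; rewrite mul1r.
Qed.

(** The upper bound with [M = 0], applied to [f - g]. *)
Lemma le_J d A (f g : 'rV[R]_d -> R) : 0 <= A -> Cc A f -> Cc A g ->
  (forall x, f x <= g x) -> J f <= J g.
Proof.
move=> A0 Cf Cg fg; have := J_ub A0 (Cc_lin (-1) Cg Cf) (lexx 0).
rewrite (J_lin _ A0 Cg Cf) mulr0 mulN1r addrC subr_le0; apply => x.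
by rewrite mulN1r addrC subr_le0.
Qed.

Lemma J_ge0 d A (f : 'rV[R]_d -> R) : 0 <= A -> Cc A f -> (forall x, 0 <= f x) -> 0 <= J f.
Proof. by move=> A0 Cf f0; rewrite -(J0 d A0); apply: (le_J A0 (@Cc0 _ _) Cf). Qed.

Lemma le_J_dist d A (f g : 'rV[R]_d -> R) e : 0 <= A -> 0 <= e -> Cc A f -> Cc A g ->
  (forall x, `|f x - g x| <= e) -> `|J f - J g| <= (2 * A) ^+ d * e.
Proof.
move=> A0 e0 Cf Cg h.
have H1 : J f - J g <= (2 * A) ^+ d * e.
  rewrite addrC -mulN1r -(J_lin _ A0 Cg Cf); apply: (J_ub A0 (Cc_lin _ Cg Cf) e0) => x.
  by rewrite mulN1r addrC (le_trans (ler_norm _)).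
have H2 : J g - J f <= (2 * A) ^+ d * e.
  rewrite addrC -mulN1r -(J_lin _ A0 Cf Cg); apply: (J_ub A0 (Cc_lin _ Cf Cg) e0) => x.
  by rewrite mulN1r addrC (le_trans (ler_norm _))// distrC.
by rewrite ler_norml H1 andbT lerNl opprB.
Qed.

Lemma J_sum d A (I : Type) (s : seq I) (f : I -> 'rV[R]_d -> R) : 0 <= A ->
  (forall i, Cc A (f i)) ->
  Cc A (fun x => \sum_(i <- s) f i x) /\ J (fun x => \sum_(i <- s) f i x) = \sum_(i <- s) J (f i).
Proof.
move=> A0 Cf; elim: s => [|i s [IC IJ]].
  by under eq_fun do rewrite big_nil; rewrite big_nil; split; [exact: Cc0|exact: J0].
under eq_fun do rewrite big_cons; rewrite big_cons; split.
  by have := Cc_lin 1 (Cf i) IC; under eq_fun do rewrite mul1r.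
by rewrite (JD A0 (Cf i) IC) IJ.
Qed.

Lemma J_cvg d A (T : topologicalType) (F : 'rV[R]_d -> T -> R) t0 : 0 <= A ->
  (forall t, Cc A (F ^~ t)) ->
  (forall x, continuous_at (x, t0) (fun z : 'rV[R]_d * T => F z.1 z.2)) ->
  continuous_at t0 (fun t => J (F ^~ t)).
Proof. by move=> A0; exact: (J_param_spec (@iint_specP R d) A0). Qed.

(** The map [c] sends the line through [y] along [u] to the line through [c y] along [v] with the
    same parameter, so the two difference quotients are the same function of [h]. It transports
    derivatives between a space, its slices and its lines. *)
Lemma affine_derive (U V : normedModType R) (f : V -> R) (c : U -> V) (u y : U) (v : V) :
  (forall h : R, c (h *: u + y) = h *: v + c y) ->
  (derivable (fun z => f (c z)) y u <-> derivable f (c y) v) /\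
  'D_u (fun z => f (c z)) y = 'D_v f (c y).
Proof.
move=> H.
have E : (fun h : R => h^-1 *: (((fun z => f (c z)) \o shift y) (h *: u) - f (c y))) =
    (fun h : R => h^-1 *: ((f \o shift (c y)) (h *: v) - f (c y))).
  by apply/funext => h /=; rewrite H.
by split; rewrite /derivable /derive E.
Qed.

(** The form in which all differential inequalities are integrated: the derivative is taken on the
    open interval only, as the equation holds only for [0 < t < T]. *)
Lemma mvt_le (f f' : R -> R) (a b C : R) : a <= b ->
  (forall x, a < x < b -> is_derive x 1 f (f' x)) ->
  {within `[a, b], continuous f} ->
  (forall x, a < x < b -> f' x <= C) -> f b - f a <= C * (b - a).
Proof.
rewrite le_eqVlt => /orP[/eqP ->|ab df cf fC]; first by rewrite !subrr mulr0.
have df' x : x \in `]a, b[ -> is_derive x 1 f (f' x) by rewrite in_itv/=; exact: df.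
have [c] := MVT ab df' cf.
rewrite in_itv/= => cab ->; by apply: ler_wpM2r (fC _ cab); rewrite subr_ge0 ltW.
Qed.

Lemma is_derive_cont (f : R -> R) x df : is_derive x (1 : R) f df -> continuous_at x f.
Proof. by move=> h; apply: differentiable_continuous; apply/derivable1_diffP; case: h. Qed.

(** The mean value theorem for the upper and the lower bound of [f' - c], on either side of [a].
    With [c] the slope at [a] it estimates a difference quotient by the oscillation of [f']. *)
Lemma mvt_dist (f f' : R -> R) (a b c e : R) :
  (forall x, `|x - a| <= `|b - a| -> is_derive x 1 f (f' x)) ->
  (forall x, `|x - a| <= `|b - a| -> `|f' x - c| <= e) ->
  `|f b - f a - c * (b - a)| <= e * `|b - a|.
Proof.
move=> df fc.
have key u v : u <= v -> (forall x, u <= x <= v -> `|x - a| <= `|b - a|) ->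
    (c - e) * (v - u) <= f v - f u <= (c + e) * (v - u).
  move=> uv H.
  have cf : {within `[u, v], continuous f}.
    apply: continuous_in_subspaceT => x; rewrite inE/= in_itv/= => /H/df; exact: is_derive_cont.
  have H' x : u < x < v -> `|x - a| <= `|b - a|.
    by move=> /andP[ax xb]; apply: H; rewrite !ltW.
  apply/andP; split.
    have : - f v - - f u <= (- (c - e)) * (v - u).
      apply: (@mvt_le (fun x => - f x) (fun x => - f' x)) => //.
      - by move=> x /H'/df h; exact: is_deriveN.
      - by move=> x; apply: continuousN; exact: cf.
      - by move=> x /H'/fc; rewrite lerN2 ler_norml => /andP[+ _]; lra.
    by rewrite mulNr; lra.
  apply: (@mvt_le f f') => // x /H'; first exact: df.
  by move=> /fc; rewrite ler_norml => /andP[_]; lra.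
have [ab|/ltW ba] := leP a b.
  have nb : `|b - a| = b - a by rewrite ger0_norm ?subr_ge0.
  have : (c - e) * (b - a) <= f b - f a <= (c + e) * (b - a).
    by apply: key ab _ => x /andP[ax xb]; rewrite nb ger0_norm ?subr_ge0// lerD2r.
  by move=> /andP[h1 h2]; rewrite nb ler_norml; apply/andP; split; lra.
have nb : `|b - a| = a - b by rewrite ler0_norm ?opprB ?subr_le0.
have : (c - e) * (a - b) <= f a - f b <= (c + e) * (a - b).
  by apply: key ba _ => x /andP[ax xb]; rewrite nb ler0_norm ?subr_le0// opprB lerD2l lerN2.
by move=> /andP[h1 h2]; rewrite nb ler_norml; apply/andP; split; lra.
Qed.

(** By [mvt_dist] the difference quotient at [x] is as close to [F' x t0] as [F' x] stays near that
    value between the two times; compactness makes this uniform over the box. *)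
Lemma J_deriv d A (F F' : 'rV[R]_d -> R -> R) (t0 e0 : R) : 0 <= A -> 0 < e0 ->
  (forall t, Cc A (F ^~ t)) -> Cc A (F' ^~ t0) ->
  (forall x t, `|t - t0| < e0 -> is_derive t 1 (F x) (F' x t)) ->
  (forall x, continuous_at (x, t0) (fun z : 'rV[R]_d * R => F' z.1 z.2)) ->
  is_derive t0 1 (fun t => J (F ^~ t)) (J (F' ^~ t0)).
Proof.
move=> A0 e00 CF CF' dF cF'.
suff H : h^-1 *: (((fun t => J (F ^~ t)) \o shift t0) (h *: 1) - J (F ^~ t0)) @[h --> 0^']
    --> J (F' ^~ t0).
  by apply: DeriveDef; [apply/cvg_ex; eexists; exact: H|exact: (cvg_lim _ H)].
apply/cvgrPdist_le => e e_gt0.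
pose B := (2 * A) ^+ d + 1.
have B0 : 0 < B by rewrite ltr_wpDl// exprn_ge0// mulr_ge0.
have := unif_cvg (@box_compact R d A) (fun x _ => cF' x) (divr_gt0 e_gt0 B0).
move=> /nbhs_ballP[r /= r0 U].
near=> h.
have h0 : h != 0 by near: h; exact: nbhs_dnbhs_neq.
have hr : `|h| < Num.min r e0.
  by near: h; apply: dnbhs0_lt; rewrite lt_min r0.
move: hr; rewrite lt_min => /andP[hr he].
rewrite /= [h *: 1]mulr1.
have -> : h^-1 *: (J (F ^~ (h + t0)) - J (F ^~ t0)) =
    J (fun x => h^-1 * (-1 * F x t0 + F x (h + t0))).
  rewrite (JZ _ A0) ?(J_lin _ A0)//; last exact: Cc_lin.
  by rewrite mulN1r addrC.
apply: (@le_trans _ _ ((2 * A) ^+ d * (e / B))); last first.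
  rewrite mulrCA -[leRHS]mulr1 ler_wpM2l ?ltW// ltr_pdivrMr// mul1r.
  by rewrite /B ltrDl.
have eB0 : 0 <= e / B by rewrite divr_ge0 ?ltW.
have CQ : Cc A (fun x => h^-1 * (-1 * F x t0 + F x (h + t0))).
  have := Cc_lin h^-1 (Cc_lin (-1) (CF t0) (CF (h + t0))) (@Cc0 d A).
  by under eq_fun do rewrite addr0.
apply: (le_J_dist A0 eB0) => // x.
have [bx|/not_box nb] := pselect (box A x); last first.
  by rewrite CF'.2// (CF t0).2// (CF (h + t0)).2// mulr0 addr0 mulr0 subrr normr0.
have := @mvt_dist (F x) (F' x) t0 (h + t0) (F' x t0) (e / B).
rewrite addrK mulN1r => W.
have hp : 0 < `|h| by rewrite normr_gt0.
rewrite -(ler_pM2r hp) -normrM mulrBl distrC [h^-1 * _]mulrC -mulrA mulVf// mulr1.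
rewrite [- _ + _]addrC; apply: W => u uh.
  by apply: dF; exact: le_lt_trans he.
apply/ltW/U => //; rewrite /ball/= distrC; exact: le_lt_trans hr.
Unshelve. all: by end_near. Qed.


Lemma iint_ge0 d (f : 'rV[R]_d -> \bar R) : (forall x, 0 <= f x)%E -> (0 <= iint f)%E.
Proof. by elim: d f => [|d IH] f f0 //=; apply: integral_ge0 => x _; exact: IH. Qed.

(** Read off the supremum over simple functions below the integrand, so that measurability of the
    inner integrals does not enter. It serves to compare with the total mass, whose integrand is not
    compactly supported. *)
Lemma le_iint d (f g : 'rV[R]_d -> \bar R) : (forall x, 0 <= f x)%E -> (forall x, f x <= g x)%E ->
  (iint f <= iint g)%E.
Proof.
elim: d f g => [|d IH] f g f0 fg //=.
have g0 x : (0 <= g x)%E by exact: le_trans (fg x).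
rewrite !ge0_integralE; [|by move=> *; exact: iint_ge0..].
rewrite !patch_setT; apply: le_ereal_sup => _ [h /= hf <-]; exists h => //= x.
by apply: le_trans (hf x) _; exact: IH.
Qed.

(** Provides the derivatives at the points where nothing is known of [mu] but where a truncation
    vanishes nearby. *)
Lemma local_derivable0 (V : normedModType R) (f : V -> R) x v :
  (\forall y \near x, f y = 0) -> derivable f x v /\ 'D_v f x = 0.
Proof.
move=> f0.
have H : h^-1 *: ((f \o shift x) (h *: v) - f x) @[h --> 0^'] --> (0 : R).
  apply: cvg_near_cst.
  have : \forall h \near 0^', f (h *: v + x) = 0.
    have c : h *: v + x @[h --> (0 : R)^'] --> x.
      rewrite -[X in _ --> X]add0r -[X in _ --> X + _](scale0r v).
      apply: cvgD; last exact: cvg_cst.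
      by apply: cvgZr_tmp; apply: cvg_within.
    exact: c _ f0.
  by apply: filterS => h /= ->; rewrite (nbhs_singleton f0) subrr scaler0.
by split; [apply/cvg_ex; eexists; exact: H|exact: cvg_lim H].
Qed.

Lemma cont_near_gt (T : topologicalType) (f : T -> R) x a : continuous_at x f -> a < f x ->
  \forall y \near x, a < f y.
Proof. by move=> cf afx; exact: (@cvgr_gt _ _ _ _ f (f x) cf). Qed.

Lemma cont_near_lt (T : topologicalType) (f : T -> R) x a : continuous_at x f -> f x < a ->
  \forall y \near x, f y < a.
Proof. by move=> cf afx; exact: (@cvgr_lt _ _ _ _ f (f x) cf). Qed.

Lemma cont_norm (T : topologicalType) (f : T -> R) x : continuous_at x f ->
  continuous_at x (fun y => `|f y|).
Proof. by move=> cf; exact: cvg_norm. Qed.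

Lemma cont_coord d (x : 'rV[R]_d) i : continuous_at x (fun y : 'rV[R]_d => y 0 i).
Proof. exact: coord_continuous. Qed.

Lemma near_out_box d A (x : 'rV[R]_d) i : A < `|x 0 i| -> \forall y \near x, A < `|(y : 'rV[R]_d) 0 i|.
Proof.
exact: (@cont_near_gt _ (fun y : 'rV[R]_d => `|y 0 i|) x A (cont_norm (@cont_coord d x i))).
Qed.

Lemma partial_Cc d A i (g : 'rV[R]_d -> R) : Cc A g -> continuous (partial i g) ->
  Cc A (partial i g).
Proof.
move=> [_ g0] c; split => // x [j hj]; apply: (local_derivable0 _ _).2.
by apply: filterS (near_out_box hj) => y yj; apply: g0; exists j.
Qed.

Lemma J_slice d A (f : 'rV[R]_d.+1 -> R) : 0 <= A -> Cc A f ->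
  J f = \int[@lebesgue_measure R]_(x in `[- A, A]) J (slice f x).
Proof.
by move=> A0 Cf; have [e _ _] := J_slice_spec (@iint_specP R d) A0 Cf; rewrite {1}/J e.
Qed.

(** Induction on the dimension. A derivative in a later coordinate commutes with slicing, and the
    inner integral vanishes by induction. For the first coordinate the inner integral is
    differentiated under the integral sign and the fundamental theorem of calculus is applied to
    it. *)
Lemma J_partial d A i (g : 'rV[R]_d -> R) : 0 <= A -> Cc A g ->
  (forall x, derivable g x (evec R i)) -> continuous (partial i g) -> J (partial i g) = 0.
Proof.
elim: d A i g => [|d IH] A i g A0 Cg dg cg; first by case: i {dg cg}.
have Cp := partial_Cc Cg cg.
have cons0 (h x : R) (y : 'rV[R]_d) : cons_rv (h *: 1 + x) y = h *: evec R 0 + cons_rv x y.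
  apply/rowP => j; rewrite [RHS]mxE [X in _ = X + _]mxE [evec R 0 0 j]mxE [h *: 1]mulr1.
  case: (unliftP ord0 j) => [k ->|->]; first by rewrite !cons_rvS mulr0 add0r.
  by rewrite !cons_rv0 mulr1.
have consS (h x : R) (y : 'rV[R]_d) j :
    cons_rv x (h *: evec R j + y) = h *: evec R (lift ord0 j) + cons_rv x y.
  apply/rowP => l; rewrite [RHS]mxE [X in _ = X + _]mxE [evec R _ 0 l]mxE.
  case: (unliftP ord0 l) => [k ->|->]; last by rewrite !cons_rv0 mulr0 add0r.
  by rewrite !cons_rvS mxE [X in X + _ = _]mxE [evec R j 0 k]mxE (inj_eq lift_inj).
case: (unliftP ord0 i) Cp cg dg => [j ->|->] Cp cg dg.
  rewrite (J_slice A0 Cp) /Rintegral integral0_eq// => x _.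
  have E y := affine_derive g (fun h => consS h x y j).
  have S : slice (partial (lift ord0 j) g) x = partial j (slice g x).
    by apply/funext => y; rewrite /slice /partial (E y).2.
  congr (_%:E); rewrite S; apply: (IH A) => //; first exact: slice_Cc.
    by move=> y; apply: (E y).1.2; exact: dg.
  by rewrite -S; exact: (slice_Cc x Cp).1.
(* One unit is added because [Cc] gives vanishing only strictly outside the box, and the boundary
   terms are taken at the endpoints. *)
have B0 : 0 <= A + 1 by rewrite addr_ge0.
have AB : A <= A + 1 by rewrite lerDl.
have ab : - (A + 1) < A + 1 by rewrite (@lt_trans _ _ 0)// ?oppr_lt0 ltr_wpDl.
have [_ _ cG'] := J_slice_spec (@iint_specP R d) A0 Cp.
have [_ _ cG] := J_slice_spec (@iint_specP R d) A0 Cg.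
have E x y := @affine_derive R^o _ g (fun x => cons_rv x y) 1 x (evec R 0) (fun h => cons0 h x y).
have dG (x : R) : is_derive x (1 : R) (fun x => J (slice g x)) (J (slice (partial ord0 g) x)).
  apply: (@J_deriv d A (fun y x => slice g x y) (fun y x => slice (partial ord0 g) x y) x 1) => //.
  - by move=> t; exact: slice_Cc.
  - exact: slice_Cc.
  - move=> y t _; apply: DeriveDef; first by apply: (E t y).1.2; exact: dg.
    by rewrite /slice /partial (E t y).2.
  - by move=> y; apply: (slice_cont cg).
rewrite (J_slice B0 (Cc_le AB Cp)) /Rintegral (@continuous_FTC2 _ _ (fun x => J (slice g x))) //.
- suff Z x : A < `|x| -> J (slice g x) = 0.
    have Aa : A < `|A + 1| by rewrite ger0_norm// ltrDl.
    by rewrite Z// Z ?normrN//= subrr.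
  move=> Ax; rewrite -(J0 d A0); congr J; apply/funext => y; apply: Cg.2.
  by exists 0; rewrite cons_rv0.
- exact: continuous_subspaceT.
- split => [x _||].
  - by case: (dG x).
  - by apply: cvg_at_right_filter; exact: cG.
  - by apply: cvg_at_left_filter; exact: cG.
- by move=> x _; rewrite derive1E; case: (dG x).
Qed.
End Functional.

(** * Truncated powers *)

Section Scalar.
Variable R : realType.
Implicit Types (a b c p q : R).

Lemma cont_id (T : topologicalType) (x : T) : continuous_at x (fun y : T => y).
Proof. exact: cvg_id. Qed.

Lemma cont_idR (x : R) : continuous_at x (fun y : R => y).
Proof. exact: cvg_id. Qed.

Lemma powRDp (x a b : R) : 0 < x -> x `^ (a + b) = x `^ a * x `^ b.
Proof. by move=> x0; rewrite powRD// (gt_eqF x0) implybT. Qed.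

Lemma cont_near_eq (T U : topologicalType) (f g : T -> U) x :
  (\forall y \near x, f y = g y) -> continuous_at x f -> continuous_at x g.
Proof.
move=> fg cf; rewrite /continuous_at -(nbhs_singleton fg).
by apply: cvg_trans cf; apply: near_eq_cvg; apply: filterS fg => y ->.
Qed.

Lemma cont_powR a (x : R) : 0 < x -> continuous_at x (fun y : R => y `^ a).
Proof. by move=> x0; exact: is_derive_cont (is_derive1_powR a x0). Qed.

(** The absolute value gives a continuous function on the whole line, which can be composed with any
    continuous function; on nonnegative arguments it is the power itself. *)
Lemma cont_abs_powR a : 0 < a -> continuous (fun y : R => `|y| `^ a).
Proof.
move=> a0 x; have [->|x0] := eqVneq x 0; last first.
  apply: (@cont_comp _ _ _ (fun y : R => `|y|) (fun y : R => y `^ a)).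
    exact: (@norm_continuous R R^o x).
  by apply: cont_powR; rewrite normr_gt0.
apply/cvgrPdist_lt => e e0; rewrite normr0 powR0 ?gt_eqF//.
have : \forall y \near (0 : R), `|y| < e `^ a^-1.
  have := @cont_near_lt R _ (fun y : R => `|y|) 0 (e `^ a^-1) (@norm_continuous R R^o 0).
  by apply; rewrite normr0 powR_gt0.
apply: filterS => y hy; rewrite sub0r normrN ger0_norm ?powR_ge0//.
have -> : e = (e `^ a^-1) `^ a by rewrite -powRrM mulVf ?gt_eqF// powRr1// ltW.
by rewrite gt0_ltr_powR// nnegrE ?powR_ge0.
Qed.

Lemma primitive (f : R -> R) (d : R) : continuous f -> (forall s, s <= d -> f s = 0) ->
  exists F : R -> R, (forall s : R, is_derive s (1 : R) F (f s)) /\ forall s, s <= d -> F s = 0.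
Proof.
move=> cf f0.
(* Starting below [d] puts every [s >= d] in the interior of an interval of integration; for [s < d]
   the primitive is locally 0. *)
pose a := d - 1.
pose F x := \int[@lebesgue_measure R]_(t in `[a, x]) f t.
have F0 s : s <= d -> F s = 0.
  move=> sd; rewrite /F /Rintegral integral0_eq// => t /=; rewrite in_itv/= => /andP[_ ts].
  by rewrite f0// (le_trans ts).
exists F; split => // s.
have [sd|ds] := ltP s d.
  have n : \forall y \near s, F y = 0.
    by apply: filterS (cont_near_lt (@cont_idR s) sd) => y yd; rewrite F0// ltW.
  have [D1 D2] := @local_derivable0 R R^o F s 1 n.
  by apply: DeriveDef => //; rewrite f0// ltW.
have as_ : a < s by rewrite (lt_le_trans _ ds)// /a ltrBlDr ltrDl.
have [||D1 D2] := @continuous_FTC1_closed R f a s (s + 1) _ _ as_ (cf s).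
- by rewrite ltrDl.
- apply: continuous_compact_integrable; first exact: segment_compact.
  exact: continuous_subspaceT.
- by apply: DeriveDef; [exact: D1|rewrite -derive1E; exact: D2].
Qed.

(** A linear ramp from 0 at [d] to 1 at [2 * d]. Continuity is enough, because the truncated powers
    are obtained by integrating their derivatives. *)
Definition cut (d s : R) : R := Num.min 1 (Num.max 0 ((s - d) / d)).

Lemma cont_max (T : topologicalType) (f g : T -> R) x : continuous_at x f ->
  continuous_at x g -> continuous_at x (fun y => Num.max (f y) (g y)).
Proof. by move=> cf cg; exact: (continuous_max cf cg). Qed.

Lemma cont_min (T : topologicalType) (f g : T -> R) x : continuous_at x f ->
  continuous_at x g -> continuous_at x (fun y => Num.min (f y) (g y)).
Proof. by move=> cf cg; exact: (continuous_min cf cg). Qed.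

Lemma cut_cont (d : R) : continuous (cut d).
Proof.
move=> s; apply: cont_min; first exact: cont_cst.
apply: cont_max; first exact: cont_cst.
by apply: contM; [apply: contD; [exact: cont_id|exact: cont_cst]|exact: cont_cst].
Qed.

Lemma cut_ge0 (d s : R) : 0 <= cut d s.
Proof. by rewrite /cut le_min ler01 le_max lexx. Qed.

Lemma cut_le1 (d s : R) : cut d s <= 1.
Proof. by rewrite /cut ge_min lexx. Qed.

Lemma cut0 (d s : R) : 0 < d -> s <= d -> cut d s = 0.
Proof.
move=> d0 sd; rewrite /cut max_l ?min_r//.
by rewrite pmulr_lle0 ?invr_gt0// subr_le0.
Qed.

Lemma cut1 (d s : R) : 0 < d -> 2 * d <= s -> cut d s = 1.
Proof.
move=> d0 sd; have h : 1 <= (s - d) / d by rewrite ler_pdivlMr// mul1r; lra.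
by rewrite /cut max_r ?min_l// (le_trans ler01).
Qed.

(** The exponent may be negative: the cutoff removes the singularity at 0. *)
Lemma cut_powR_cont (d b : R) (th : R -> R) : 0 < d -> continuous th -> (forall s, s <= d -> th s = 0) ->
  continuous (fun s => th s * s `^ b).
Proof.
move=> d0 cth th0 s; have [sd|ds] := ltP s d.
  apply: (@cont_near_eq _ _ (fun=> 0)); last exact: cont_cst.
  by apply: filterS (cont_near_lt (@cont_idR s) sd) => y yd; rewrite th0 ?mul0r// ltW.
by apply: contM; [exact: cth|apply: cont_powR; exact: lt_le_trans ds].
Qed.

Lemma powR_within a (x y : R) : 0 < a -> 0 <= x -> {within `[x, y], continuous (fun s : R => s `^ a)}.
Proof.
move=> a0 x0; apply: (@subspace_eq_continuous _ _ _ (fun s : R => `|s| `^ a)).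
  by move=> s; rewrite inE/= in_itv/= => /andP[xs _]; rewrite ger0_norm// (le_trans x0).
exact/continuous_subspaceT/cont_abs_powR.
Qed.

Lemma within_D (f g : R -> R) (x y : R) : {within `[x, y], continuous f} ->
  {within `[x, y], continuous g} -> {within `[x, y], continuous (fun s => f s + g s)}.
Proof. by move=> cf cg s; exact: (continuousD (cf s) (cg s)). Qed.

Lemma within_N (f : R -> R) (x y : R) : {within `[x, y], continuous f} ->
  {within `[x, y], continuous (fun s => - f s)}.
Proof. by move=> cf s; exact: (continuousN (cf s)). Qed.

Lemma le_powR (a x y : R) : 0 < a -> 0 <= x -> x <= y -> x `^ a <= y `^ a.
Proof.
move=> a0 x0 xy; apply: ge0_ler_powR => //; first exact: ltW.
  by rewrite nnegrE (le_trans x0).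
Qed.

Lemma within_M (f g : R -> R) (x y : R) : {within `[x, y], continuous f} ->
  {within `[x, y], continuous g} -> {within `[x, y], continuous (fun s => f s * g s)}.
Proof. by move=> cf cg s; exact: (continuousM (cf s) (cg s)). Qed.

Lemma within_cst c (x y : R) : {within `[x, y], continuous (fun _ : R => c)}.
Proof. by apply: continuous_subspaceT => s; exact: cvg_cst. Qed.

(** The derivative of [H] is that of [k * s ^ a] times a factor in [[0, 1]]. Hence the difference of
    the two is nondecreasing, and it stops growing at [2 * d], where it is at most
    [k * (2 * d) ^ a]. *)
Lemma truncated_primitive (H th : R -> R) (d k a : R) : 0 < d -> 0 <= k -> 0 < a ->
  (forall s, 0 <= th s <= 1) -> (forall s, 2 * d <= s -> th s = 1) ->
  (forall s, s <= d -> H s = 0) ->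
  (forall s : R, is_derive s (1 : R) H (k * a * (th s * s `^ (a - 1)))) ->
  forall s, 0 <= s -> [/\ 0 <= H s, H s <= k * s `^ a & k * s `^ a - k * (2 * d) `^ a <= H s].
Proof.
move=> d0 k0 a0 th01 th1 H0 dH s s0.
have H00 : H 0 = 0 by rewrite H0 ?ltW.
have cH (x y : R) : {within `[x, y], continuous H}.
  by apply: continuous_subspaceT => u; exact: is_derive_cont (dH u).
have dP (u : R) : 0 < u -> is_derive u (1 : R) (fun v : R => k * v `^ a) (k * a * u `^ (a - 1)).
  move=> u0; have := is_deriveZ k (is_derive1_powR a u0).
  by rewrite /GRing.scale/= mulrA.
have cP (x y : R) : 0 <= x -> {within `[x, y], continuous (fun v : R => k * v `^ a)}.
  by move=> x0; apply: within_M; [exact: within_cst|exact: powR_within].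
have H_ge0 u : 0 <= u -> 0 <= H u.
  move=> u0.
  have := @mvt_le R (fun v => - H v) (fun v => - (k * a * (th v * v `^ (a - 1)))) 0 u 0 u0.
  rewrite mul0r H00 oppr0 !subr0 oppr_le0; apply.
  - by apply: within_N; exact: cH.
  - move=> v _; rewrite oppr_le0 !mulr_ge0 ?powR_ge0 ?(ltW a0)//.
    by case/andP: (th01 v).
split.
- exact: H_ge0.
- have := @mvt_le R (fun v => H v + - (k * v `^ a))
    (fun v => k * a * (th v * v `^ (a - 1)) + - (k * a * v `^ (a - 1))) 0 s 0 s0.
  rewrite mul0r H00 powR0 ?gt_eqF// mulr0 !subr0 subr_le0; apply.
  + by move=> v /andP[v0 _]; apply: is_deriveD; apply: is_deriveN; exact: dP.
  + apply: within_D; first exact: cH.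
    by apply: within_N; exact: cP.
  + move=> v _; rewrite subr_le0; apply: ler_wpM2l; first by rewrite mulr_ge0// ltW.
    by rewrite ler_piMl ?powR_ge0//; case/andP: (th01 v).
- have [sd|ds] := leP s (2 * d).
    apply: le_trans (H_ge0 _ s0); rewrite subr_le0 ler_wpM2l//.
    exact: le_powR.
  have d20 : 0 <= 2 * d by rewrite mulr_ge0 ?ltW.
  have := @mvt_le R (fun v => (k * v `^ a) + - H v)
    (fun v => k * a * v `^ (a - 1) + - (k * a * (th v * v `^ (a - 1)))) (2 * d) s 0 (ltW ds).
  rewrite mul0r => W.
  have : (k * s `^ a) + - H s - ((k * (2 * d) `^ a) + - H (2 * d)) <= 0.
    apply: W.
    + move=> v /andP[v0 _]; have v0' : 0 < v by exact: le_lt_trans v0.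
      by have h1 := dP _ v0'; apply: is_deriveD; apply: is_deriveN.
    + apply: within_D; first exact: cP.
      by apply: within_N; exact: cH.
    + by move=> v /andP[v0 _]; rewrite th1 ?mul1r ?subrr// ltW.
  by have := H_ge0 _ d20; lra.
Qed.

Lemma small_powR a (e : R) : 0 < a -> 0 < e -> exists2 d, 0 < d & (2 * d) `^ a <= e.
Proof.
move=> a0 e0; exists (e `^ a^-1 / 2); first by rewrite divr_gt0 ?powR_gt0.
by rewrite mulrC divfK// -powRrM mulVf ?gt_eqF// powRr1// ltW.
Qed.

(** [Phi] truncates [s ^ p] and [h] truncates [s ^ ((p + be) / 2)]. Without cutoff the algebraic
    relation is [p (p - 1) s ^ (p - 2 + be) = c ((p + be) / 2) ^ 2 s ^ (p + be - 2)], which gives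
    the constant [c]; the cutoff contributes its square to both sides. *)
Lemma truncation p (be M e : R) : 1 < p -> 0 < be -> 0 < M -> 0 < e ->
  exists (d : R) (Phi phi phi' h h' : R -> R),
  [/\ 0 < d,
    (forall s, s <= d -> [/\ Phi s = 0, phi s = 0, phi' s = 0, h s = 0 & h' s = 0]),
    (continuous phi' /\ continuous h'),
    [/\ forall s : R, is_derive s (1 : R) Phi (phi s),
      forall s : R, is_derive s (1 : R) phi (phi' s) &
      forall s : R, is_derive s (1 : R) h (h' s)] &
    [/\ forall s, 0 < s -> phi' s * s `^ be = 4 * p * (p - 1) / (p + be) ^+ 2 * h' s ^+ 2,
      forall s, 0 <= s <= M -> s `^ p - e <= Phi s <= s `^ p &
      forall s, 0 <= s <= M -> s `^ ((p + be) / 2) - e <= h s <= s `^ ((p + be) / 2) /\ 0 <= h s]].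
Proof.
move=> p1 be0 M0 e0.
have p0 : 0 < p by exact: lt_trans p1.
have pm0 : 0 < p - 1 by rewrite subr_gt0.
set q := p + be; have q0 : 0 < q by rewrite addr_gt0.
have q20 : 0 < q / 2 by rewrite divr_gt0.
(* [d1] makes the error of [phi] at most [e / M], hence that of [Phi] at most [e] on [[0, M]]; [d2]
   makes the error of [h] at most [e]. *)
have [d1 d10 hd1] := small_powR pm0 (divr_gt0 e0 (mulr_gt0 p0 M0)).
have [d2 d20 hd2] := small_powR q20 e0.
pose d := Num.min d1 d2.
have d0 : 0 < d by rewrite lt_min d10.
pose th s := cut d s ^+ 2.
have cth : continuous th by move=> s; apply: contM; exact: cut_cont.
have th0 s : s <= d -> th s = 0 by move=> sd; rewrite /th cut0// expr0n.
have th01 s : 0 <= th s <= 1.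
  by rewrite /th exprn_ge0 ?cut_ge0//= exprn_ile1 ?cut_ge0 ?cut_le1.
have th1 s : 2 * d <= s -> th s = 1 by move=> sd; rewrite /th cut1// expr1n.
pose phi' s := p * (p - 1) * (th s * s `^ (p - 1 - 1)).
pose h' s := 1 * (q / 2) * (cut d s * s `^ (q / 2 - 1)).
have cphi' : continuous phi'.
  by move=> s; apply: contM; [exact: cont_cst|exact: (cut_powR_cont d0 cth th0)].
have ch' : continuous h'.
  move=> s; apply: contM; first exact: cont_cst.
  by apply: (cut_powR_cont d0 (@cut_cont d)) => u; exact: cut0.
have phi'0 s : s <= d -> phi' s = 0 by move=> sd; rewrite /phi' th0// mul0r mulr0.
have h'0 s : s <= d -> h' s = 0 by move=> sd; rewrite /h' cut0// mul0r mulr0.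
have [phi [dphi phi0]] := primitive cphi' phi'0.
have [h [dh h0]] := primitive ch' h'0.
have cphi : continuous phi by move=> s; exact: is_derive_cont (dphi s).
have [Phi [dPhi Phi0]] := primitive cphi phi0.
have Bphi := truncated_primitive d0 (ltW p0) pm0 th01 th1 phi0 dphi.
have cut01 s : 0 <= cut d s <= 1 by rewrite cut_ge0 cut_le1.
have Bh := truncated_primitive d0 ler01 q20 cut01 (fun s => @cut1 d s d0) h0 dh.
exists d, Phi, phi, phi', h, h'; split => //.
  by move=> s sd; rewrite Phi0 ?phi0 ?phi'0 ?h0 ?h'0.
split.
- move=> s s0; rewrite /phi' /h' mul1r /th.
  have -> : s `^ (p - 1 - 1) = s `^ (q / 2 - 1) * s `^ (q / 2 - 1) / s `^ be.
    apply: (@mulIf _ (s `^ be)); first by rewrite gt_eqF// powR_gt0.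
    rewrite divfK ?gt_eqF ?powR_gt0// -!powRDp//; congr (_ `^ _).
    by rewrite /q; lra.
  have hb : s `^ be != 0 by rewrite gt_eqF// powR_gt0.
  by field; rewrite hb (gt_eqF q0).
- have cPhi (x y : R) : {within `[x, y], continuous Phi}.
    by apply: continuous_subspaceT => u; exact: is_derive_cont (dPhi u).
  have Phi00 : Phi 0 = 0 by rewrite Phi0 ?ltW.
  move=> s /andP[s0 sM]; apply/andP; split.
    have := @mvt_le R (fun v => v `^ p + - Phi v) (fun v => p * v `^ (p - 1) + - phi v) 0 s (e / M) s0.
    rewrite powR0 ?gt_eqF// Phi00 !subr0 => W.
    have : s `^ p + - Phi s <= e / M * s.
      apply: W.
      + move=> v /andP[v0 _]; have h1 := is_derive1_powR p v0; exact: is_deriveD.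
      + apply: within_D; first exact: powR_within.
        by apply: within_N; exact: cPhi.
      + move=> v /andP[v0 _]; have [_ _] := Bphi v (ltW v0).
        have : p * (2 * d) `^ (p - 1) <= e / M.
          apply: (@le_trans _ _ (p * (2 * d1) `^ (p - 1))).
            apply: ler_wpM2l; first exact: ltW.
            apply: le_powR => //; first by rewrite mulr_ge0 ?ltW.
            by rewrite ler_pM2l// ge_min lexx.
          apply: (le_trans (ler_wpM2l (ltW p0) hd1)).
          by rewrite le_eqVlt; apply/orP; left; apply/eqP; field; rewrite !gt_eqF.
        by lra.
    have : e / M * s <= e by rewrite mulrAC ler_pdivrMr// ler_wpM2l// ltW.
    by lra.
  have := @mvt_le R (fun v => Phi v + - v `^ p) (fun v => phi v + - (p * v `^ (p - 1))) 0 s 0 s0.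
  rewrite powR0 ?gt_eqF// Phi00 mul0r !subr0 subr_le0; apply.
  + move=> v /andP[v0 _]; have h1 := is_derive1_powR p v0; exact: is_deriveD.
  + apply: within_D; first exact: cPhi.
    by apply: within_N; exact: powR_within.
  + by move=> v /andP[v0 _]; have [_ h1 _] := Bphi v (ltW v0); rewrite subr_le0.
- move=> s /andP[s0 _]; have [h1 h2 h3] := Bh s s0; split => //.
  move: h2 h3; rewrite !mul1r => -> h3; rewrite andbT; apply: le_trans h3; rewrite lerB//.
  apply: le_trans hd2; apply: le_powR => //; first by rewrite mulr_ge0 ?ltW.
  by rewrite ler_pM2l// ge_min lexx orbT.
Qed.

(** Convexity of the exponent-to-power map: both exponentials are bounded below by the tangent of
    [expR] at the mean exponent [m], and the linear terms cancel. The case [z = 0], where the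
    logarithm is useless, is separate. *)
Lemma powR_interp (z th q : R) : 0 <= z -> 0 <= th <= 1 -> 0 < 1 - th + th * q -> 0 < q ->
  z `^ (1 - th + th * q) <= (1 - th) * z + th * z `^ q.
Proof.
rewrite le_eqVlt => /orP[/eqP <-|z0] /andP[t0 t1] s0 q0.
  by rewrite !powR0 ?gt_eqF// !mulr0 addr0.
rewrite /powR gt_eqF//; set u := ln z.
have -> : z = expR u by rewrite /u lnK.
set m := (1 - th + th * q) * u.
have e1 : expR u = expR m * expR (u - m) by rewrite -expRD addrC subrK.
have e2 : expR (q * u) = expR m * expR (q * u - m) by rewrite -expRD addrC subrK.
rewrite e1 e2 [leRHS](_ : _ = expR m * ((1 - th) * expR (u - m) + th * expR (q * u - m))); last by ring.
rewrite ler_pMr ?expR_gt0//.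
have h1 := expR_ge1Dx (u - m); have h2 := expR_ge1Dx (q * u - m).
have t1' : 0 <= 1 - th by rewrite subr_ge0.
apply: le_trans (lerD (ler_wpM2l t1' h1) (ler_wpM2l t0 h2)).
by rewrite /m le_eqVlt; apply/orP; left; apply/eqP; ring.
Qed.

(** For [z > 0], [z ^ k = z * expR ((k - 1) ln z)] is at least [z + (k - 1) z ln z], and
    [z ln z >= z - 1]. *)
Lemma bernoulli_powR (z k : R) : 0 <= z -> 1 <= k -> 1 + k * (z - 1) <= z `^ k.
Proof.
move=> z0 k1; have k0 : 0 < k by exact: lt_le_trans k1.
have ki : 0 <= k^-1 <= 1 by rewrite invr_ge0 ltW//= invf_le1.
have [->|zn0] := eqVneq z 0; first by rewrite powR0 ?gt_eqF//; lra.
have zp : 0 < z by rewrite lt_neqAle eq_sym zn0.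
rewrite /powR gt_eqF//; have h := expR_ge1Dx (k * ln z - ln z).
have -> : expR (k * ln z) = z * expR (k * ln z - ln z).
  by rewrite -{2}[z]lnK ?posrE// -expRD addrC subrK.
have h2 : 1 - z^-1 <= ln z.
  have := expR_ge1Dx (- ln z); rewrite expRN lnK ?posrE//; lra.
have h3 : 1 - z^-1 = (z - 1) / z by field.
have h4 : z - 1 <= z * ln z by rewrite mulrC -ler_pdivrMr// -h3.
have h5 : z * (1 + (k * ln z - ln z)) <= z * expR (k * ln z - ln z) by rewrite ler_pM2l.
apply: le_trans h5.
have h6 : (k - 1) * (z - 1) <= (k - 1) * (z * ln z) by rewrite ler_wpM2l// subr_ge0.
have -> : z * (1 + (k * ln z - ln z)) = z + (k - 1) * (z * ln z) by ring.
lra.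
Qed.

End Scalar.

(** * Moment inequalities *)

Section Weighted.
Variables (R : realType) (d : nat) (A : R) (w : 'rV[R]_d -> R).
Hypotheses (A0 : 0 <= A) (cw : continuous w) (w0 : forall x, 0 <= w x).

Definition I (g : 'rV[R]_d -> R) : R := J (fun x => g x * w x).

Lemma Cc_mulr (f g : 'rV[R]_d -> R) : Cc A f -> continuous g -> Cc A (fun x => f x * g x).
Proof.
move=> [cf f0] cg; split => [x|x /f0 ->]; last by rewrite mul0r.
exact: contM (cf x) (cg x).
Qed.

Lemma Cc_comp (f : 'rV[R]_d -> R) (g : R -> R) : Cc A f -> continuous g -> g 0 = 0 ->
  Cc A (fun x => g (f x)).
Proof.
move=> [cf f0] cg g0; split => [x|x /f0 ->] //.
exact: cont_comp (cf x) (cg (f x)).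
Qed.

Lemma I_lin (f g : 'rV[R]_d -> R) a : Cc A f -> Cc A g -> I (fun x => a * f x + g x) = a * I f + I g.
Proof.
move=> Cf Cg; rewrite -(J_lin _ A0 (Cc_mulr Cf cw) (Cc_mulr Cg cw)); congr J.
by apply/funext => x; rewrite mulrDl mulrA.
Qed.

Lemma IZ (f : 'rV[R]_d -> R) a : Cc A f -> I (fun x => a * f x) = a * I f.
Proof.
move=> Cf; rewrite -(JZ _ A0 (Cc_mulr Cf cw)); congr J.
by apply/funext => x; rewrite mulrA.
Qed.

Lemma le_I (f g : 'rV[R]_d -> R) : Cc A f -> Cc A g -> (forall x, f x <= g x) -> I f <= I g.
Proof.
move=> Cf Cg fg; apply: (le_J A0 (Cc_mulr Cf cw) (Cc_mulr Cg cw)) => x.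
exact: ler_wpM2r.
Qed.

Lemma I_ge0 (f : 'rV[R]_d -> R) : Cc A f -> (forall x, 0 <= f x) -> 0 <= I f.
Proof. by move=> Cf f0; apply: (J_ge0 A0 (Cc_mulr Cf cw)) => x; rewrite mulr_ge0. Qed.

Lemma Cc_powR (f : 'rV[R]_d -> R) s : 0 < s -> Cc A f -> (forall x, 0 <= f x) ->
  Cc A (fun x => f x `^ s).
Proof.
move=> s0 Cf f0; have := Cc_comp Cf (cont_abs_powR s0).
rewrite normr0 powR0 ?gt_eqF// => /(_ erefl).
by under eq_fun do rewrite ger0_norm//.
Qed.

Variables (f eta : 'rV[R]_d -> R).
Hypotheses (Cf : Cc A f) (f0 : forall x, 0 <= f x) (Ceta : Cc A eta) (eta0 : forall x, 0 <= eta x).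
Hypotheses (eta1 : forall x, f x != 0 -> eta x = 1) (Ieta : I eta <= 1).

(** The pointwise interpolation is applied to [f / c] and integrated. The scale [c] is chosen with
    [Q = c ^ (q - 1)], so that the two terms contribute at most [(1 - th) c ^ (s - 1)] and
    [th c ^ (s - 1)]; the bound on [I f] settles the first. *)
Lemma lyapunov s q : 1 <= s -> s <= q -> 1 < q -> I f <= 1 -> 0 < I (fun x => f x `^ q) ->
  I (fun x => f x `^ s) <= I (fun x => f x `^ q) `^ ((s - 1) / (q - 1)).
Proof.
move=> s1 sq q1 If Aq.
have s0 : 0 < s by exact: lt_le_trans s1.
have q0 : 0 < q by exact: lt_trans q1.
have qm : 0 < q - 1 by rewrite subr_gt0.
pose th := (s - 1) / (q - 1).
have th0 : 0 <= th by rewrite divr_ge0 ?subr_ge0// ltW.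
have th1 : th <= 1 by rewrite ler_pdivrMr// mul1r lerB.
have Es : s = 1 - th + th * q by rewrite /th; field; rewrite gt_eqF.
set Q := I (fun x => f x `^ q) in Aq *.
pose c := Q `^ (q - 1)^-1.
have c0 : 0 < c by rewrite powR_gt0.
have pw x : f x `^ s <= (1 - th) * c `^ (s - 1) * f x + th * c `^ (s - q) * f x `^ q.
  have h := @powR_interp R (f x / c) th q.
  rewrite -Es in h.
  have h' : (f x / c) `^ s <= (1 - th) * (f x / c) + th * (f x / c) `^ q.
    by apply: h; rewrite ?th0 ?th1// divr_ge0// ltW.
  have E t : f x `^ t = c `^ t * (f x / c) `^ t.
    by rewrite -powRM ?(ltW c0) ?divr_ge0 ?(ltW c0)// mulrC divfK// gt_eqF.
  rewrite (E s) (E q) -[X in _ + X]mulrA [c `^ (s - q) * _]mulrA -powRDp// subrK.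
  have -> : (1 - th) * c `^ (s - 1) * f x = c `^ s * ((1 - th) * (f x / c)).
    have -> : c `^ s = c `^ (s - 1) * c.
      by rewrite -{3}[c]powRr1 ?(ltW c0)// -powRDp// subrK.
    by field; rewrite gt_eqF.
  rewrite [th * (c `^ s * _)]mulrCA -mulrDr ler_wpM2l// ?powR_ge0//.
have CQ := Cc_powR q0 Cf f0.
have C1 : Cc A (fun x => (1 - th) * c `^ (s - 1) * f x).
  have := Cc_lin ((1 - th) * c `^ (s - 1)) Cf (@Cc0 R d A).
  by under eq_fun do rewrite addr0.
have le1 : I (fun x => f x `^ s) <= (1 - th) * c `^ (s - 1) * I f + th * c `^ (s - q) * Q.
  apply: (@le_trans _ _ (I (fun x => (1 - th) * c `^ (s - 1) * f x + th * c `^ (s - q) * f x `^ q))).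
    apply: le_I => //; first exact: Cc_powR.
    apply: Cc_lin => //.
    have := Cc_lin (th * c `^ (s - q)) CQ (@Cc0 R d A).
    by under eq_fun do rewrite addr0.
  rewrite I_lin// ?IZ//.
  have := Cc_lin (th * c `^ (s - q)) CQ (@Cc0 R d A).
  by under eq_fun do rewrite addr0.
apply: (le_trans le1).
have EQ : Q = c `^ (q - 1) by rewrite /c -powRrM mulVf ?gt_eqF// powRr1// ltW.
have -> : Q `^ ((s - 1) / (q - 1)) = c `^ (s - 1) by rewrite /c -powRrM mulrC.
have -> : th * c `^ (s - q) * Q = th * c `^ (s - 1).
  by rewrite [X in _ * X = _]EQ -mulrA -powRDp// addrA subrK.
have h1 : (1 - th) * c `^ (s - 1) * I f <= (1 - th) * c `^ (s - 1) * 1.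
  by apply: ler_wpM2l => //; rewrite mulr_ge0 ?powR_ge0// subr_ge0.
apply: le_trans (lerD h1 (lexx _)) _.
by rewrite mulr1 -mulrDl subrK mul1r.
Qed.

(** The Bernoulli inequality for [f ^ p / F] with exponent [k = q / p], integrated. Its constant
    term [1 - k] is carried by [eta] and is nonpositive, so [I eta <= 1] is the right direction. *)
Lemma jensen p q : 0 < p -> p <= q -> 0 < I (fun x => f x `^ p) ->
  I (fun x => f x `^ p) `^ (q / p) <= I (fun x => f x `^ q).
Proof.
move=> p0 pq F0; have q0 : 0 < q by exact: lt_le_trans pq.
set F := I (fun x => f x `^ p) in F0 *.
pose k := q / p; have k1 : 1 <= k by rewrite ler_pdivlMr// mul1r.
have CP := Cc_powR p0 Cf f0; have CQ := Cc_powR q0 Cf f0.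
have Fk : 0 < F `^ k by rewrite powR_gt0.
have pw x : F `^ k * (1 - k) * eta x + (F `^ k * (k / F)) * f x `^ p <= f x `^ q.
  have [fx|fx] := eqVneq (f x) 0.
    rewrite fx !powR0 ?gt_eqF// mulr0 addr0 mulr_le0_ge0//.
    by rewrite mulr_ge0_le0 ?(ltW Fk)// subr_le0.
  have h := @bernoulli_powR R (f x `^ p / F) k _ k1.
  have {}h : 1 + k * (f x `^ p / F - 1) <= (f x `^ p / F) `^ k.
    by apply: h; rewrite divr_ge0 ?powR_ge0// ltW.
  have E : f x `^ q = F `^ k * (f x `^ p / F) `^ k.
    rewrite -powRM ?divr_ge0 ?powR_ge0 ?(ltW F0)// mulrC divfK ?gt_eqF// -powRrM.
    by rewrite /k mulrC divfK// gt_eqF.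
  rewrite E eta1// mulr1 -[X in _ + X]mulrA -mulrDr ler_pM2l//.
  by apply: le_trans h; rewrite le_eqVlt; apply/orP; left; apply/eqP; ring.
have C2 : Cc A (fun x => F `^ k * (k / F) * f x `^ p).
  have := Cc_lin (F `^ k * (k / F)) CP (@Cc0 R d A).
  by under eq_fun do rewrite addr0.
have := le_I (Cc_lin (F `^ k * (1 - k)) Ceta C2) CQ pw.
rewrite I_lin// IZ// -/F => h; apply: le_trans h.
have -> : F `^ k * (k / F) * F = F `^ k * k by field; rewrite gt_eqF.
have : F `^ k * (1 - k) * I eta >= F `^ k * (1 - k) * 1.
  by apply: ler_wnM2l => //; rewrite mulr_ge0_le0 ?(ltW Fk)// subr_le0.
lra.
Qed.

(** With [Q], [B], [F] the moments of order [q], [q / 2], [p]: the Lyapunov inequality at [q / 2]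
    (at least 1 since [q >= 2]) gives [B ^ 2 <= Q * Q ^ (- 1 / (q - 1))]. At [p] it gives [Q ^ (- 1
    / (q - 1)) <= F ^ (- 1 / (p - 1))], and the right-hand side is the exponential [X]. So the
    variance is at least [Q (1 - X)], and Jensen bounds [Q] below. *)
Lemma variance_lower p q : 1 < p -> 2 <= q -> p <= q -> I f <= 1 -> 1 <= I (fun x => f x `^ p) ->
  I (fun x => f x `^ p) `^ (q / p) * (1 - expR (- ((p - 1)^-1 * ln (I (fun x => f x `^ p)))))
  <= I (fun x => f x `^ q) - I (fun x => f x `^ (q / 2)) ^+ 2.
Proof.
move=> p1 q2 pq If F1.
have p0 : 0 < p by exact: lt_trans p1.
have q1 : 1 < q by lra.
have q0 : 0 < q by lra.
have p1' : 0 < p - 1 by rewrite subr_gt0.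
have q1' : 0 < q - 1 by rewrite subr_gt0.
have hs1 : 1 <= q / 2 by lra.
have hs2 : q / 2 <= q by lra.
have hs0 : 0 < q / 2 by lra.
have hJ := jensen p0 pq (lt_le_trans ltr01 F1).
have F0 := lt_le_trans ltr01 F1.
have Q0 : 0 < I (fun x => f x `^ q) by apply: lt_le_trans hJ; rewrite powR_gt0.
have hB : I (fun x => f x `^ (q / 2)) <= I (fun x => f x `^ q) `^ ((q / 2 - 1) / (q - 1)).
  exact: lyapunov.
have hF := lyapunov (ltW p1) pq q1 If Q0.
have B0 : 0 <= I (fun x => f x `^ (q / 2)).
  by apply: I_ge0 => [|x]; [exact: Cc_powR|exact: powR_ge0].
set Q := I (fun x => f x `^ q) in hJ Q0 hB hF *.
set B := I (fun x => f x `^ (q / 2)) in hB B0 *.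
set F := I (fun x => f x `^ p) in hJ F1 F0 hF *.
clearbody Q B F.
set X := expR _.
have EX : X = F `^ (- (p - 1)^-1) by rewrite /X /powR gt_eqF// mulNr.
have X1 : X <= 1.
  rewrite /X -[leRHS]expR0 ler_expR oppr_le0; apply: mulr_ge0; last exact: ln_ge0.
  by rewrite invr_ge0 ltW.
have hX : Q `^ (- (q - 1)^-1) <= X.
  rewrite EX !powRN lef_pV2 ?posrE ?powR_gt0//.
  apply: (@le_trans _ _ ((Q `^ ((p - 1) / (q - 1))) `^ (p - 1)^-1)).
    by apply: le_powR => //; rewrite ?invr_gt0// ltW.
  by rewrite -powRrM mulrAC mulfV ?gt_eqF// mul1r.
have hB2 : B ^+ 2 <= Q * X.
  apply: (@le_trans _ _ ((Q `^ ((q / 2 - 1) / (q - 1))) ^+ 2)).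
    by rewrite ler_pXn2r// nnegrE powR_ge0.
  have -> : (Q `^ ((q / 2 - 1) / (q - 1))) ^+ 2 = Q * Q `^ (- (q - 1)^-1).
    have -> : Q * Q `^ (- (q - 1)^-1) = Q `^ (1 + - (q - 1)^-1) by rewrite powRDp// powRr1// ltW.
    rewrite expr2 -powRDp//; congr (_ `^ _).
    by field; rewrite gt_eqF.
  by rewrite ler_pM2l.
apply: (@le_trans _ _ (Q * (1 - X))); first by rewrite ler_wpM2r// subr_ge0.
by rewrite mulrBr mulr1 lerB.
Qed.

End Weighted.

(** * Lower bounds for [1 - expR (- K)] *)

Lemma one_minus_exp_half (R : realType) (K : R) : 1 <= K -> 1 / 2 <= 1 - expR (- K).
Proof.
move=> K1; have := expR_ge1Dx K => h.
have : expR (- K) <= 2^-1 by rewrite expRN lef_pV2 ?posrE ?expR_gt0//; lra.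
lra.
Qed.

(** From [expR K >= 1 + K] the left-over is at least [K / (1 + K)], and [1 + K <= 2]. *)
Lemma one_minus_exp_lin (R : realType) (K : R) : 0 <= K <= 1 -> K / 2 <= 1 - expR (- K).
Proof.
move=> /andP[K0 K1]; have h := expR_ge1Dx K.
have : expR (- K) <= (1 + K)^-1 by rewrite expRN lef_pV2 ?posrE ?expR_gt0//; lra.
have : (1 + K)^-1 <= 1 - K / 2.
  rewrite -[(1 + K)^-1]mul1r ler_pdivrMr; last by lra.
  by have := mulr_ge0 K0 (_ : 0 <= 1 - K); nra.
lra.
Qed.

(** * Integration by parts in the ball *)

Section Ball.
Variables (R : realType) (d : nat).

(** Restriction to the line through [x] along [v] reduces this to one variable, so that directional
    derivability of [f] suffices. *)
Lemma is_derive_chain (V : normedModType R) (f : V -> R) (g : R -> R) (x v : V) (df dg : R) :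
  is_derive x v f df -> is_derive (f x) (1 : R) g dg -> is_derive x v (fun y => g (f y)) (dg * df).
Proof.
move=> [fx fe] hg.
pose c (h : R^o) := h *: v + x.
have c0 : c 0 = x by rewrite /c scale0r add0r.
have E (h : R) : c (h *: 1 + 0) = h *: v + c 0 by rewrite c0 /c addr0 [h *: 1]mulr1.
have Ef := @affine_derive R R^o V f c 1 0 v E.
have Eg := @affine_derive R R^o V (fun y => g (f y)) c 1 0 v E.
have h1 : is_derive (0 : R) (1 : R) (fun z : R => f (c z)) df.
  by apply: DeriveDef; [apply: Ef.1.2; rewrite c0|rewrite Ef.2 c0].
have h2 : is_derive (f (c 0)) (1 : R) g dg by rewrite c0.
have [h3 h4] := @is_derive1_comp R g (fun z => f (c z)) 0 _ _ h2 h1.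
by rewrite -c0; apply: DeriveDef; [apply: Eg.1.1|rewrite -Eg.2 h4].
Qed.

Lemma coord_le_enorm (x : 'rV[R]_d) i : `|x 0 i| <= enorm x.
Proof.
rewrite /enorm -sqrtr_sqr ler_wsqrtr// (bigD1 i)//= lerDl.
by apply: sumr_ge0 => j _; exact: sqr_ge0.
Qed.

Lemma contB (T : topologicalType) (f g : T -> R) (x : T) :
  continuous_at x f -> continuous_at x g -> continuous_at x (fun y => f y - g y).
Proof. by move=> cf cg; exact: (continuousB cf cg). Qed.

Lemma cont_sum (T : topologicalType) (I : Type) (s : seq I) (f : I -> T -> R) x :
  (forall i, continuous_at x (f i)) -> continuous_at x (fun y => \sum_(i <- s) f i y).
Proof.
move=> cf; elim: s => [|i s IH].
  by apply: (@cont_near_eq _ _ (fun=> 0)); [apply: nearW => y; rewrite big_nil|exact: cont_cst].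
apply: (@cont_near_eq _ _ (fun y => f i y + \sum_(j <- s) f j y)).
  by apply: nearW => y; rewrite big_cons.
exact: contD.
Qed.

Lemma cont_sq : continuous (fun x : 'rV[R]_d => \sum_(i < d) x 0 i ^+ 2).
Proof.
move=> x; apply: cont_sum => i.
by apply: contM; exact: cont_coord.
Qed.

Lemma enorm_cont : continuous (@enorm R d).
Proof. by move=> x; apply: (@cont_comp 'rV[R]_d R R _ Num.sqrt x); [exact: cont_sq|exact: sqrt_continuous]. Qed.

Lemma enorm_ge0 (x : 'rV[R]_d) : 0 <= enorm x.
Proof. exact: sqrtr_ge0. Qed.

Lemma sqr_enorm (x : 'rV[R]_d) : enorm x ^+ 2 = \sum_(i < d) x 0 i ^+ 2.
Proof. by rewrite sqr_sqrtr// sumr_ge0// => i _; exact: sqr_ge0. Qed.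

Variable r : R.

(** Support inside the open ball, stated pointwise: partial derivatives inherit it, and nothing has
    to be known of the function near the sphere. *)
Definition tame (a : 'rV[R]_d -> R) : Prop := forall x, ~ oball r x -> \forall y \near x, a y = 0.

Lemma oball_near (x : 'rV[R]_d) : oball r x -> \forall y \near x, oball r y.
Proof. by move=> bx; have := @cont_near_lt R 'rV[R]_d (@enorm R d) x r (@enorm_cont x) bx. Qed.

Lemma tame_Cc a : tame a -> (forall x, oball r x -> continuous_at x a) -> Cc r a.
Proof.
move=> ta ca; split => [x|x [i ri]].
  have [bx|nbx] := pselect (oball r x); first exact: ca.
  apply: (@cont_near_eq _ _ (fun=> 0)); last exact: cont_cst.
  by apply: filterS (ta x nbx) => y ->.
apply: (nbhs_singleton (ta x _)); rewrite /oball/= => xr.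
by have := lt_trans (lt_le_trans ri (coord_le_enorm x i)) xr; rewrite ltxx.
Qed.

Lemma near_forall (T : topologicalType) (I : finType) (P : I -> T -> Prop) (x : T) :
  (forall i, \forall y \near x, P i y) -> \forall y \near x, forall i, P i y.
Proof. by move=> h; exact: filter_forall. Qed.

Lemma near_partial0 (a : 'rV[R]_d -> R) (x : 'rV[R]_d) i : (\forall y \near x, a y = 0) ->
  \forall y \near x, partial i a (y : 'rV[R]_d) = 0.
Proof.
move=> /nbhs_interior; apply: filterS => y hy.
exact: (local_derivable0 _ hy).2.
Qed.

Lemma is_derive_partial (a : 'rV[R]_d -> R) x i : derivable a x (evec R i) ->
  is_derive x (evec R i) a (partial i a x).
Proof. by move=> h; apply: DeriveDef. Qed.

Variable V : 'rV[R]_d -> R.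
Hypotheses (dV : forall x i, derivable V x (evec R i)) (cV : continuous V).
Hypothesis cdV : forall i, continuous (partial i V).

Lemma dens_cont : continuous (dens V).
Proof.
move=> x; apply: (@cont_comp _ _ _ (fun y => - V y) expR).
  by apply: continuousN; exact: cV.
exact: continuous_expR.
Qed.

Lemma dens_derive x i : is_derive x (evec R i) (dens V) (- partial i V x * dens V x).
Proof.
rewrite mulrC; apply: (@is_derive_chain _ (fun y => - V y) expR).
have h : is_derive x (evec R i) V (partial i V x) by exact: DeriveDef.
exact: is_deriveN.
Qed.

(** The field [a * partial i b * dens V] has partial derivatives of integral 0, and differentiating
    the weight produces the drift term. At each point off the ball either factor may be the one
    vanishing nearby, so [mu ^ (beta + 1)] can take either role without boundary regularity. *)
Lemma ibp (a b : 'rV[R]_d -> R) :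
  (forall x, oball r x -> continuous_at x a /\ forall i, derivable a x (evec R i) /\
     continuous_at x (partial i a)) ->
  (forall x, oball r x -> forall i, [/\ derivable b x (evec R i), continuous_at x (partial i b),
     derivable (partial i b) x (evec R i) & continuous_at x (partial i (partial i b))]) ->
  (forall x, ~ oball r x -> (\forall y \near x, a y = 0) \/ (\forall y \near x, b y = 0)) ->
  0 <= r ->
  [/\ Cc r (fun x => a x * (laplacian b x - grad_dot V b x) * dens V x),
     Cc r (fun x => grad_dot a b x * dens V x) &
     J (fun x => a x * (laplacian b x - grad_dot V b x) * dens V x) =
     - J (fun x => grad_dot a b x * dens V x)].
Proof.
move=> Ha Hb Hab r0.
have cw := dens_cont.
have cL x : oball r x -> continuous_at x (fun x => laplacian b x - grad_dot V b x).
  move=> bx; apply: continuousD.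
    by apply: cont_sum => i; have [] := Hb x bx i.
  apply: continuousN; apply: cont_sum => i; apply: contM; first exact: cdV.
  by have [_ h _ _] := Hb x bx i; exact: h.
have C1 : Cc r (fun x => a x * (laplacian b x - grad_dot V b x) * dens V x).
  apply: tame_Cc => [x /Hab[]|x bx].
  - by apply: filterS => y ->; rewrite !mul0r.
  - move=> b0.
    have b1 : \forall y \near x, forall i, partial i b y = 0.
      by apply: near_forall => i; exact: near_partial0.
    have b2 : \forall y \near x, forall i, partial i (partial i b) y = 0.
      apply: near_forall => i; apply: near_partial0.
      by apply: filterS b1 => y.
    apply: filterS2 b1 b2 => y h1 h2.
    rewrite /laplacian /grad_dot big1 ?big1 ?subrr ?mulr0 ?mul0r// => i _.
    by rewrite h1 mulr0.
  - by apply: contM; [apply: contM; [case: (Ha x bx)|exact: cL]|exact: cw].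
have cG x : oball r x -> continuous_at x (grad_dot a b).
  move=> bx; apply: cont_sum => i; apply: contM.
    by case: (Ha x bx) => _ /(_ i)[].
  by have [_ h _ _] := Hb x bx i; exact: h.
have C2 : Cc r (fun x => grad_dot a b x * dens V x).
  apply: tame_Cc => [x /Hab h|x bx]; last by apply: contM; [exact: cG|exact: cw].
  have : \forall y \near x, forall i, partial i a y * partial i b y = 0.
    apply: near_forall => i; case: h => /(near_partial0 i); apply: filterS => y ->.
      by rewrite mul0r.
    by rewrite mulr0.
  by apply: filterS => y h1; rewrite /grad_dot big1 ?mul0r.
split => //.
pose g i x := a x * partial i b x * dens V x.
pose T i x := partial i a x * partial i b x * dens V x + a x * partial i (partial i b) x * dens V x
  - a x * partial i b x * partial i V x * dens V x.
have tg i : tame (g i).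
  move=> x /Hab[|/(near_partial0 i)]; apply: filterS => y; rewrite /g => ->; by rewrite ?mulr0 !mul0r.
have dg i x : derivable (g i) x (evec R i) /\ partial i (g i) x = T i x.
  have [bx|nbx] := pselect (oball r x); last first.
    have [h1 h2] := local_derivable0 (evec R i) (tg i x nbx).
    split => //; rewrite /partial h2 /T.
    case: (Hab x nbx) => h.
      by rewrite (nbhs_singleton h) (nbhs_singleton (near_partial0 i h)) !mul0r addr0 subr0.
    rewrite (nbhs_singleton (near_partial0 i h)).
    rewrite (nbhs_singleton (near_partial0 i (near_partial0 i h))).
    by rewrite !mulr0 !mul0r addr0 subr0.
  have [d1 d2 d3 d4] := Hb x bx i.
  have [ca /(_ i)[a1 a2]] := Ha x bx.
  have e1 := is_derive_partial a1; have e2 := is_derive_partial d3.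
  have e3 := is_deriveM e1 e2; have e4 := is_deriveM e3 (dens_derive x i).
  split; first by case: e4.
  have -> : partial i (g i) x = 'D_(evec R i) (a * partial i b * dens V) x by [].
  rewrite (@derive_val _ _ _ _ _ _ _ e4) /T !fctE /GRing.scale/=.
  ring.
have ET i : T i = partial i (g i) by apply/funext => x; rewrite (dg i x).2.
have CT i : Cc r (T i).
  have tT : tame (T i) by rewrite ET => x nbx; apply: near_partial0; exact: tg.
  apply: (tame_Cc tT _) => x bx.
  have [d1 d2 d3 d4] := Hb x bx i.
  have [ca /(_ i)[a1 a2]] := Ha x bx.
  apply: (contB (contD _ _) _); (apply: contM; last exact: cw).
  - exact: (contM a2 d2).
  - exact: (contM ca d4).
  - exact: (contM (contM ca d2) (@cdV i x)).
have JT i : J (T i) = 0.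
  have Cg : Cc r (g i).
    apply: tame_Cc => // x bx; apply: contM; last exact: cw.
    by have [_ h _ _] := Hb x bx i; apply: contM; [case: (Ha x bx)|exact: h].
  rewrite ET; apply: (J_partial r0 Cg); first by move=> x; case: (dg i x).
  by rewrite -ET; case: (CT i).
apply/eqP; rewrite -addr_eq0 -(JD r0 C1 C2).
have [_ hs] := J_sum (index_enum 'I_d) r0 CT.
rewrite (_ : (fun x => _) = (fun x => \sum_(i < d) T i x)); first by rewrite hs big1.
apply/funext => x; rewrite /laplacian /grad_dot /T !big_split/= sumrN.
rewrite mulrBr mulrBl !mulr_sumr !mulr_suml.
under [X in _ - X + _]eq_bigr do rewrite [partial _ V x * _]mulrC mulrA.
rewrite [LHS]addrC [LHS]addrA; congr (_ - _); congr (_ + _); exact: eq_bigr.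
Qed.

End Ball.

(** * Evolution of truncated moments *)

Lemma near_is_derive (R : realType) (V : normedModType R) (f g : V -> R) (x v : V) (df : R) :
  (\forall y \near x, f y = g y) -> is_derive x v f df -> is_derive x v g df.
Proof.
move=> fg hf.
have n0 : \forall y \near x, g y - f y = 0 by apply: filterS fg => y ->; rewrite subrr.
have [h1 h2] := local_derivable0 v n0.
have h3 : is_derive x v (fun y => g y - f y) 0 by exact: DeriveDef.
have h4 := is_deriveD hf h3.
by rewrite addr0 in h4; congr (is_derive x v _ df) : h4; apply/funext => y /=; rewrite fctE addrC subrK.
Qed.

Lemma eq_is_derive (R : realType) (V : normedModType R) (f g : V -> R) (x v : V) (df : R) :
  (forall y, f y = g y) -> is_derive x v f df -> is_derive x v g df.
Proof. by move=> /funext ->. Qed.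

Lemma zero_is_derive (R : realType) (V : normedModType R) (f : V -> R) (x v : V) :
  (forall y, f y = 0) -> is_derive x v f 0.
Proof.
move=> f0; have n0 : \forall y \near x, f y = 0 by exact: filterE.
by have [h1 h2] := local_derivable0 v n0; exact: DeriveDef.
Qed.

Section Evolution.
Variables (R : realType) (d : nat) (V : 'rV[R]_d -> R) (beta r T : R).
Variables (vs : 'rV[R]_d -> R) (mu : 'rV[R]_d -> R -> R).
Hypotheses (dV : forall x i, derivable V x (evec R i)) (cV : continuous V).
Hypothesis cdV : forall i, continuous (partial i V).
Hypotheses (beta0 : 0 < beta) (r0 : 0 < r) (T0 : 0 < T).
Hypothesis sol : classical_solution V beta r T vs mu.

Let w := dens V.
Let cw : continuous w := dens_cont cV.
Let w_gt0 x : 0 < w x := expR_gt0 _.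
Let w0 x : 0 <= w x := ltW (w_gt0 x).
Let r0' : 0 <= r := ltW r0.

Definition clamp (t : R) : R := Num.max 0 (Num.min t T).

(** Extension by 0 in space, continuous because [mu] vanishes on the sphere, and constant in time
    beyond [[0, T]]. This turns continuity on the closed cylinder into continuity everywhere. *)
Definition ext (x : 'rV[R]_d) (t : R) : R := if enorm x < r then mu x (clamp t) else 0.

Lemma clamp_cont : continuous clamp.
Proof.
move=> t; apply: cont_max; first exact: cont_cst.
by apply: cont_min; [exact: cont_idR|exact: cont_cst].
Qed.

Lemma clamp_bound t : 0 <= clamp t <= T.
Proof. by rewrite /clamp le_max lexx/= ge_max ltW//= ge_min lexx orbT. Qed.

Lemma clampE t : 0 <= t <= T -> clamp t = t.
Proof. by move=> /andP[t0 tT]; rewrite /clamp min_l// max_r. Qed.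

Lemma ext_ge0 x t : 0 <= ext x t.
Proof.
rewrite /ext; case: ifPn => // xr; have [mu0 _] := sol.
by apply: mu0; [exact: ltW|exact: clamp_bound].
Qed.

Lemma ext_out x t : ~ oball r x -> ext x t = 0.
Proof. by rewrite /oball/= /ext => /negP/negbTE ->. Qed.

Lemma ext_in x t : cball r x -> 0 <= t <= T -> ext x t = mu x t.
Proof.
move=> xr tT; rewrite /ext clampE//; case: ltP => // rx.
have [_ [_ [_ [_ [_ sph]]]]] := sol; rewrite sph//.
by apply/eqP; rewrite eq_le rx andbT.
Qed.

Lemma ext_cont : continuous (fun z : 'rV[R]_d * R => ext z.1 z.2).
Proof.
have [_ [cmu _]] := sol; move=> [x t] /=.
apply/cvgrPdist_lt => e e0.
have ce : continuous_at (x, t) (fun z : 'rV[R]_d * R => enorm z.1).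
  apply: (@cont_comp _ _ _ (fun z : 'rV[R]_d * R => z.1) (@enorm R d)); first exact: cvg_fst.
  exact: enorm_cont.
have cc : continuous_at (x, t) (fun z : 'rV[R]_d * R => (z.1, clamp z.2)).
  apply: cont_pair; first exact: cvg_fst.
  apply: (@cont_comp _ _ _ (fun z : 'rV[R]_d * R => z.2) clamp); first exact: cvg_snd.
  exact: clamp_cont.
have [rx|xr] := ltP r (enorm x).
  have : \forall z \near (x, t), r < enorm z.1 by exact: (cont_near_gt ce rx).
  apply: filterS => z rz; rewrite !ext_out ?subrr ?normr0// /oball/= => h.
    by have := lt_trans h rz; rewrite ltxx.
  by have := lt_trans h rx; rewrite ltxx.
pose D := [set z : 'rV[R]_d * R | cball r z.1 /\ 0 <= z.2 <= T].
have Dx : D (x, clamp t) by split => //; exact: clamp_bound.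
move/subspace_continuousP: cmu => /(_ _ Dx)/cvgrPdist_lt/(_ e e0) W.
have : \forall z \near (x, t), D (z.1, clamp z.2) -> `|mu x (clamp t) - mu z.1 (clamp z.2)| < e.
  exact: (cc _ W).
have E y' s' : cball r y' -> ext y' s' = mu y' (clamp s').
  move=> yr; rewrite -(@ext_in y' (clamp s'))//; last exact: clamp_bound.
  by rewrite /ext (clampE (clamp_bound _)).
have Ex : ext x t = mu x (clamp t) by exact: E.
have [xlt|rx'] := ltP (enorm x) r.
  have : \forall z \near (x, t), enorm z.1 < r by exact: (cont_near_lt ce xlt).
  apply: filterS2 => -[y s] /= yr h; rewrite Ex E ?ltW//; last exact: (ltW yr).
  by apply: h; split; [exact: (ltW yr)|exact: clamp_bound].
(* Here [x] lies on the sphere. Neighbours in the closed ball are covered by the continuity of [mu]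
   there, the others by [ext = 0]. *)
apply: filterS => -[y s] /= h.
have x0 : ext x t = 0 by rewrite ext_out// /oball/= => h'; have := lt_le_trans h' rx'; rewrite ltxx.
have [yr|ry] := leP (enorm y) r.
  by rewrite Ex E//; apply: h; split => //; exact: clamp_bound.
rewrite x0 ext_out ?subr0 ?normr0// /oball/= => h'.
by have := lt_trans h' ry; rewrite ltxx.
Qed.

Lemma ext_cont_x t : continuous (ext ^~ t).
Proof. by move=> x; exact: (@cont_fst _ _ _ (fun z : 'rV[R]_d * R => ext z.1 z.2) x t (@ext_cont (x, t))). Qed.

Lemma ext_small (x : 'rV[R]_d) (t e : R) : 0 < e -> ~ oball r x -> \forall z \near (x, t), ext (z : 'rV[R]_d * R).1 z.2 < e.
Proof.
move=> e0 nbx; apply: (@cont_near_lt R _ (fun z : 'rV[R]_d * R => ext z.1 z.2) (x, t) e (@ext_cont (x, t))).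
by rewrite /= ext_out.
Qed.

Lemma ext_small_x (x : 'rV[R]_d) (t e : R) : 0 < e -> ~ oball r x -> \forall y \near x, ext y t < e.
Proof.
move=> e0 nbx; apply: (@cont_near_lt R _ (ext ^~ t) x e (@ext_cont_x t x)).
by rewrite /= ext_out.
Qed.

Lemma out_oball (x : 'rV[R]_d) i : r < `|x 0 i| -> ~ oball r x.
Proof.
move=> ri xr; have := lt_trans (lt_le_trans ri (coord_le_enorm x i)) xr; by rewrite ltxx.
Qed.

Lemma ext_Cc t : Cc r (ext ^~ t).
Proof.
split; first exact: ext_cont_x.
by move=> x [i ri]; rewrite ext_out//; exact: out_oball ri.
Qed.

Lemma ext_bounded : exists2 B, 1 <= B & forall x t, ext x t <= B.
Proof.
pose K := (box r : set 'rV[R]_d) `*` `[0, T]%classic.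
have cK : compact K by apply: compact_setX; [exact: box_compact|exact: segment_compact].
have cE : {within K, continuous (fun z : 'rV[R]_d * R => ext z.1 z.2)}.
  by apply: continuous_subspaceT; exact: ext_cont.
have [N [_ HN]] := compact_bounded (continuous_compact cE cK).
exists (Num.max 1 (N + 1)); first by rewrite le_max lexx.
move=> x t; have [bx|nbx] := pselect (oball r x); last first.
  by rewrite ext_out// le_max ler01.
rewrite le_max; apply/orP; right.
apply: le_trans (ler_norm _) _; apply: HN; first by rewrite ltrDl.
exists (x, clamp t) => /=.
  split => /=; last by rewrite in_itv/=; exact: clamp_bound.
  by move=> i /=; exact: le_trans (coord_le_enorm x i) (ltW bx).
by rewrite /ext (clampE (clamp_bound _)).
Qed.

(* On the support of the truncations the spatial gradient of [mu] is read off
   that of the smooth function [mu ^ (beta + 1)]. *)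
Definition grad_mu (i : 'I_d) (x : 'rV[R]_d) (t : R) : R :=
  (beta + 1)^-1 * mu x t `^ (- beta) * partial i (fun y => mu y t `^ (beta + 1)) x.

(** * Spatial derivatives of truncations at a fixed time *)

Section Time.
Variable t : R.
Hypothesis tT : 0 < t < T.

Let tT' : 0 <= t <= T.
Proof. by case/andP: tT => h1 h2; rewrite !ltW. Qed.

Let W (y : 'rV[R]_d) : R := mu y t `^ (beta + 1).
Let m0 : 0 < beta + 1 := addr_gt0 beta0 ltr01.

Lemma W_C2 x i : oball r x -> [/\ derivable W x (evec R i), continuous_at x (partial i W),
  derivable (partial i W) x (evec R i) & continuous_at x (partial i (partial i W))].
Proof.
move=> bx; have [_ [_ [H _]]] := sol; have [_ [_ /(_ i)[h1 [h2 /(_ i)[h3 h4]]]]] := H x t bx tT.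
split; [exact: h1| |exact: h3|].
  exact: (@cont_fst _ _ _ (fun z : 'rV[R]_d * R => partial i (fun y => mu y z.2 `^ (beta + 1)) z.1) x t h2).
exact: (@cont_fst _ _ _
  (fun z : 'rV[R]_d * R => partial i (partial i (fun y => mu y z.2 `^ (beta + 1))) z.1) x t h4).
Qed.

Lemma ext_mu x : oball r x -> ext x t = mu x t.
Proof. by move=> bx; apply: ext_in => //; exact: ltW. Qed.

Variables (dl : R) (phi phi' : R -> R).
Hypotheses (dl0 : 0 < dl) (phi0 : forall s, s <= dl -> phi s = 0 /\ phi' s = 0).
Hypothesis dphi : forall s : R, is_derive s (1 : R) phi (phi' s).
Hypothesis cphi' : continuous phi'.

Let a (x : 'rV[R]_d) : R := phi (ext x t).

Lemma trunc_tame (g : R -> R) : (forall s, s <= dl -> g s = 0) -> tame r (fun x => g (ext x t)).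
Proof.
move=> g0 x nbx; apply: filterS (ext_small_x t dl0 nbx) => y yd; by rewrite g0// ltW.
Qed.

(** Below the level [dl] the composite is locally 0, whatever the regularity of [mu]. At or above it
    the point is in the ball, [W x > 0] and [mu = W ^ (1 / (beta + 1))] nearby, so the chain rule
    applies to [W]. *)
Lemma trunc_derive x i : is_derive x (evec R i) a (phi' (ext x t) * grad_mu i x t).
Proof.
have [sm|lg] := ltP (ext x t) dl.
  have n : \forall y \near x, a y = 0.
    apply: filterS (@cont_near_lt R _ (ext ^~ t) x dl (@ext_cont_x t x) sm) => y yd.
    by rewrite /a (phi0 (ltW yd)).1.
  have [h1 h2] := local_derivable0 (evec R i) n.
  by apply: DeriveDef => //; rewrite h2 (phi0 (ltW sm)).2 mul0r.
have bx : oball r x.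
  by apply: contrapT => /(ext_out t) h; move: lg; rewrite h leNgt dl0.
have mu0 : 0 < mu x t by rewrite -ext_mu//; exact: lt_le_trans lg.
have [h1 _ _ _] := W_C2 i bx.
have hW : is_derive x (evec R i) W (partial i W x) by exact: DeriveDef.
have Wx : 0 < W x by rewrite powR_gt0.
have hr := is_derive_chain hW (is_derive1_powR (beta + 1)^-1 Wx).
have Er y : oball r y -> W y `^ (beta + 1)^-1 = ext y t.
  move=> yr; rewrite -powRrM mulfV ?gt_eqF// powRr1 ?ext_mu//.
  by rewrite -ext_mu// ext_ge0.
have hp : is_derive (W x `^ (beta + 1)^-1) (1 : R) phi (phi' (ext x t)) by rewrite Er.
have hc := is_derive_chain hr hp.
apply: (@near_is_derive R _ (fun y => phi (W y `^ (beta + 1)^-1)) a).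
  by apply: filterS (oball_near bx) => y /Er E; rewrite /a -E.
rewrite /grad_mu -/W; suff -> : mu x t `^ (- beta) = W x `^ ((beta + 1)^-1 - 1) by [].
rewrite -powRrM; congr (_ `^ _).
by field; rewrite gt_eqF.
Qed.

Lemma trunc_partial i : partial i a = fun x => phi' (ext x t) * grad_mu i x t.
Proof. by apply/funext => x; have h := trunc_derive x i; rewrite /partial derive_val. Qed.

Lemma trunc_partial_cont i : continuous (partial i a).
Proof.
rewrite trunc_partial => x; have [sm|lg] := ltP (ext x t) dl.
  apply: (@cont_near_eq _ _ (fun=> 0)); last exact: cont_cst.
  apply: filterS (@cont_near_lt R _ (ext ^~ t) x dl (@ext_cont_x t x) sm) => y yd.
  by rewrite (phi0 (ltW yd)).2 mul0r.
have bx : oball r x.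
  by apply: contrapT => /(ext_out t) h; move: lg; rewrite h leNgt dl0.
have mu0 : 0 < mu x t by rewrite -ext_mu//; exact: lt_le_trans lg.
have [_ h2 _ _] := W_C2 i bx.
apply: (@cont_near_eq _ _ (fun y => phi' (ext y t) * ((beta + 1)^-1 * ext y t `^ (- beta) * partial i W y))).
  by apply: filterS (oball_near bx) => y yr; rewrite /grad_mu ext_mu.
apply: contM; first exact: (@cont_comp _ _ _ (ext ^~ t) phi' x (@ext_cont_x t x) (@cphi' _)).
apply: contM => //; apply: contM; first exact: cont_cst.
apply: (@cont_comp _ _ _ (ext ^~ t) (fun y => y `^ (- beta)) x (@ext_cont_x t x)).
by apply: cont_powR; rewrite ext_mu.
Qed.

Lemma trunc_C1 : C1 a.
Proof.
split; first by move=> i x; case: (trunc_derive x i).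
split; last exact: trunc_partial_cont.
by move=> x; exact: (@cont_comp _ _ _ (ext ^~ t) phi x (@ext_cont_x t x) (is_derive_cont (dphi _))).
Qed.

End Time.


Lemma trunc_Cc (g : R -> R) t : continuous g -> g 0 = 0 -> Cc r (fun x => g (ext x t)).
Proof. by move=> cg g0; exact: (Cc_comp (@ext_Cc t) cg g0). Qed.

Lemma near_time (t : R) : 0 < t < T -> exists2 e0, 0 < e0 & forall s, `|s - t| < e0 -> 0 < s < T.
Proof.
move=> /andP[t0 tT]; exists (Num.min t (T - t)); first by rewrite lt_min t0 subr_gt0.
by move=> s; rewrite lt_min !ltr_norml => /andP[/andP[h1 h2] /andP[h3 h4]]; apply/andP; split; lra.
Qed.

Lemma ext_time_derive x s : oball r x -> 0 < s < T -> is_derive s (1 : R) (ext x) (derive1 (mu x) s).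
Proof.
move=> bx sT; have [_ [_ [H _]]] := sol; have [hd _] := H x s bx sT.
apply: (@near_is_derive R R^o (mu x) (ext x)); last by rewrite derive1E; exact: DeriveDef.
have [e e0 he] := near_time sT.
have : \forall u \near s, `|u - s| < e.
  have := @cont_near_lt R R (fun u => `|u - s|) s e; apply; last by rewrite subrr normr0.
  apply: cont_norm; apply: contD; [exact: cont_idR|exact: cont_cst].
apply: filterS => u /he /andP[u0 uT]; rewrite ext_in//; first exact: ltW.
by rewrite !ltW.
Qed.

(* The weak form of the equation, tested against [phi (mu)]. *)
Lemma energy t dl (Phi phi phi' h h' : R -> R) c : 0 < t < T -> 0 < dl ->
  (forall s, s <= dl -> [/\ Phi s = 0, phi s = 0, phi' s = 0, h s = 0 & h' s = 0]) ->
  continuous phi' -> continuous h' ->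
  (forall s : R, is_derive s (1 : R) Phi (phi s)) ->
  (forall s : R, is_derive s (1 : R) phi (phi' s)) ->
  (forall s : R, is_derive s (1 : R) h (h' s)) ->
  (forall s, 0 < s -> phi' s * s `^ beta = c * h' s ^+ 2) ->
  is_derive t (1 : R) (fun s => J (fun x => Phi (ext x s) * w x))
    (- (c * J (fun x => grad_sq (fun y => h (ext y t)) x * w x))) /\
  Cc r (fun x => grad_sq (fun y => h (ext y t)) x * w x).
Proof.
move=> tT dl0 van cphi' ch' dPhi dphi dh alg.
have cPhi : continuous Phi by move=> s; exact: is_derive_cont (dPhi s).
have cphi : continuous phi by move=> s; exact: is_derive_cont (dphi s).
have dl_0 : 0 <= dl by exact: ltW.
have [Phi00 phi00 phi'00 h00 h'00] := van 0 dl_0.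
have vphi s : s <= dl -> phi s = 0 /\ phi' s = 0 by move=> /van[].
have vh s : s <= dl -> h s = 0 /\ h' s = 0 by move=> /van[].
pose F (x : 'rV[R]_d) s := Phi (ext x s) * w x.
(* Off the ball the time derivative of [mu] is arbitrary, but the factor [phi (ext x s)] vanishes in
   a neighbourhood. *)
pose F' (x : 'rV[R]_d) s := phi (ext x s) * derive1 (mu x) s * w x.
have CF s : Cc r (F ^~ s) by apply: Cc_mulr => //; exact: trunc_Cc.
have cF' x : continuous_at (x, t) (fun z : 'rV[R]_d * R => F' z.1 z.2).
  have [bx|nbx] := pselect (oball r x).
    have [_ [_ [H _]]] := sol; have [_ [hc _]] := H x t bx tT.
    apply: contM; last by apply: (@cont_comp _ _ _ (fun z : 'rV[R]_d * R => z.1) w); [exact: cvg_fst|exact: cw].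
    apply: contM; last exact: hc.
    by apply: (@cont_comp _ _ _ (fun z : 'rV[R]_d * R => ext z.1 z.2) phi); [exact: ext_cont|exact: cphi].
  apply: (@cont_near_eq _ _ (fun=> 0)); last exact: cont_cst.
  apply: filterS (@ext_small x t dl dl0 nbx) => z zd.
  by rewrite /F' (vphi _ (ltW zd)).1 !mul0r.
have CF' : Cc r (F' ^~ t).
  split => [x|x [i ri]].
    exact: (@cont_fst _ _ _ (fun z : 'rV[R]_d * R => F' z.1 z.2) x t (cF' x)).
  by rewrite /F' ext_out ?phi00 ?mul0r//; exact: out_oball ri.
have [e0 e00 he0] := near_time tT.
have dF x s : `|s - t| < e0 -> is_derive s (1 : R) (F x) (F' x s).
  move=> /he0 sT; have [bx|nbx] := pselect (oball r x).
    have h1 := is_derive_chain (ext_time_derive bx sT) (dPhi (ext x s)).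
    have h2 := is_deriveZ (w x) h1.
    by rewrite /F' mulrC; apply: eq_is_derive h2 => u; rewrite /F mulrC.
  rewrite /F' ext_out// phi00 !mul0r.
  by apply: (@zero_is_derive R R^o) => u; rewrite /F ext_out// Phi00 mul0r.
have key := J_deriv r0' e00 CF CF' dF cF'.
pose W (y : 'rV[R]_d) : R := mu y t `^ (beta + 1).
pose a (x : 'rV[R]_d) : R := phi (ext x t).
have [da [ca cda]] := trunc_C1 tT dl0 vphi dphi cphi'.
have m0 : 0 < beta + 1 by exact: addr_gt0.
have [|||C1 C2 E1] := @ibp R d r V dV cV cdV a W _ _ _ r0'.
- by move=> x bx; split; [exact: ca|move=> i; split; [exact: da|exact: cda]].
- by move=> x bx i; exact: (W_C2 tT).
- move=> x nbx; left; exact: (@trunc_tame t dl dl0 phi (fun s sd => (vphi s sd).1) x nbx).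
(* Pointwise, the product of gradients is [(beta + 1) phi' u ^ beta |grad u| ^ 2], and [alg] turns
   [phi' u ^ beta] into [c h' ^ 2]. *)
have hG x : grad_dot a W x = (beta + 1) * c * grad_sq (fun y => h (ext y t)) x.
  rewrite /grad_dot /grad_sq mulr_sumr; apply: eq_bigr => i _.
  rewrite (trunc_partial tT dl0 vphi dphi) (trunc_partial tT dl0 vh dh).
  have [->|nz] := eqVneq (ext x t) 0; first by rewrite phi'00 h'00 !mul0r expr0n/= mulr0.
  have ep : 0 < ext x t by rewrite lt_neqAle eq_sym nz ext_ge0.
  have bx : oball r x by apply: contrapT => /(ext_out t) /eqP; rewrite (negbTE nz).
  have hW : partial i W x = (beta + 1) * ext x t `^ beta * grad_mu i x t.
    rewrite /grad_mu -(ext_mu tT bx) powRN -/W.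
    have hb : ext x t `^ beta != 0 by rewrite gt_eqF// powR_gt0.
    by field; rewrite hb gt_eqF.
  rewrite hW exprMn.
  have -> : (beta + 1) * c * (h' (ext x t) ^+ 2 * grad_mu i x t ^+ 2) =
    (beta + 1) * (c * h' (ext x t) ^+ 2) * grad_mu i x t ^+ 2 by ring.
  by rewrite -alg//; ring.
have CG : Cc r (fun x => grad_sq (fun y => h (ext y t)) x * w x).
  apply: tame_Cc => [x nbx|x bx].
    have th := @trunc_tame t dl dl0 h (fun s sd => (vh s sd).1) x nbx.
    have : \forall y \near x, forall i, partial i (fun y => h (ext y t)) y = 0.
      by apply: near_forall => i; exact: near_partial0.
    by apply: filterS => y h1; rewrite /grad_sq big1 ?mul0r// => i _; rewrite h1 expr0n.
  apply: contM; last exact: cw.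
  have [_ [_ cdh]] := trunc_C1 tT dl0 vh dh ch'.
  by apply: cont_sum => i; apply: contM; exact: cdh.
split; last exact: CG.
suff -> : - (c * J (fun x => grad_sq (fun y => h (ext y t)) x * w x)) = J (F' ^~ t) by exact: key.
have -> : F' ^~ t = fun x => (1 + beta)^-1 * (a x * (laplacian W x - grad_dot V W x) * w x).
  apply/funext => x; rewrite /F'.
  have [bx|nbx] := pselect (oball r x).
    have [_ [_ [_ [pde _]]]] := sol; rewrite (pde x t bx tT) /a -/W.
    by rewrite [LHS]mulrAC mulrC !mulrA; congr (_ * _); rewrite -!mulrA; congr (_ * _); rewrite mulrC.
  by rewrite /a ext_out// phi00 !mul0r mulr0.
rewrite (JZ _ r0' C1) E1.
have -> : (fun x => grad_dot a W x * dens V x) =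
    (fun x => (beta + 1) * c * (grad_sq (fun y => h (ext y t)) x * w x)).
  by apply/funext => x; rewrite hG mulrA.
rewrite (JZ _ r0' CG).
have n0 : 1 + beta != 0 by rewrite gt_eqF// addrC.
by field; rewrite n0.
Qed.

End Evolution.

(** * A compactly supported subsolution *)

Section Bump.
Variables (R : realType) (d : nat).

Lemma pow_derive n (s : R) : is_derive s (1 : R) (fun y : R => y ^+ n) (n%:R * s ^+ n.-1).
Proof.
have h := @is_deriveX R R^o id n s 1 1 (is_derive_id _ _).
by rewrite [_%:A]mulr1 in h; apply: eq_is_derive h => y; rewrite fctE.
Qed.

(** At 0 the difference quotient is at most [|h|] for [|h| < 1], because the exponent is at least
    2. *)
Lemma posp_derive n (s : R) :
  is_derive s (1 : R) (fun y : R => Num.max y 0 ^+ n.+2) (n.+2%:R * Num.max s 0 ^+ n.+1).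
Proof.
have [s0|s0|->] := ltgtP s 0.
- rewrite expr0n mulr0; apply: (@near_is_derive R R^o (fun=> 0)).
    by apply: filterS (cont_near_lt (@cont_idR R s) s0) => y y0; rewrite max_r ?expr0n// ltW.
- apply: (@near_is_derive R R^o (fun y => y ^+ n.+2)).
    by apply: filterS (cont_near_gt (@cont_idR R s) s0) => y y0; rewrite max_l// ltW.
  exact: pow_derive.
- rewrite expr0n mulr0.
  have H : h^-1 *: (((fun y : R => Num.max y 0 ^+ n.+2) \o shift 0) (h *: 1) - Num.max 0 0 ^+ n.+2)
      @[h --> (0 : R)^'] --> (0 : R).
    apply/cvgrPdist_le => e e0; near=> h.
    have h0 : h != 0 by near: h; exact: nbhs_dnbhs_neq.
    have : `|h| < Num.min 1 e by near: h; apply: dnbhs0_lt; rewrite lt_min ltr01.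
    rewrite lt_min => /andP[h1 he].
    rewrite /= addr0 [h *: 1]mulr1 maxxx expr0n subr0 sub0r normrN normrM normfV.
    have mh : `|Num.max h 0 ^+ n.+2| <= `|h| * `|h|.
      rewrite normrX !exprS mulrA; apply: (@le_trans _ _ (`|Num.max h 0| * `|Num.max h 0| * 1)).
        rewrite ler_wpM2l ?mulr_ge0//; apply: exprn_ile1 => //.
        by rewrite ger0_norm ?le_max ?lexx ?orbT// ge_max ler01 (le_trans (ler_norm _))// ltW.
      have mm : `|Num.max h 0| <= `|h|.
        by rewrite ger0_norm ?le_max ?lexx ?orbT// ge_max ler_norm normr_ge0.
      by rewrite mulr1; exact: ler_pM.
    have hp : 0 < `|h| by rewrite normr_gt0.
    rewrite mulrC ler_pdivrMr//; apply: (le_trans mh); rewrite ler_wpM2r//; exact: ltW.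
  by apply: DeriveDef; [apply/cvg_ex; eexists; exact: H|exact: (cvg_lim _ H)].
Unshelve. all: by end_near. Qed.

Lemma coord_derive (x : 'rV[R]_d) i j :
  is_derive x (evec R i) (fun y : 'rV[R]_d => y 0 j) (j == i)%:R.
Proof.
have H : h^-1 *: (((fun y : 'rV[R]_d => y 0 j) \o shift x) (h *: evec R i) - x 0 j)
    @[h --> (0 : R)^'] --> ((j == i)%:R : R).
  apply: cvg_near_cst; near=> h.
  have h0 : h != 0 by near: h; exact: nbhs_dnbhs_neq.
  by rewrite /= /evec !mxE addrK eqxx/= [_ *: _]mulrA mulVf// mul1r.
by apply: DeriveDef; [apply/cvg_ex; eexists; exact: H|exact: (cvg_lim _ H)].
Unshelve. all: by end_near. Qed.

Lemma sq_derive (x : 'rV[R]_d) i :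
  is_derive x (evec R i) (fun y : 'rV[R]_d => \sum_(j < d) y 0 j ^+ 2) (2 * x 0 i).
Proof.
have h j : is_derive x (evec R i) (fun y : 'rV[R]_d => y 0 j ^+ 2) (2 * x 0 j * (j == i)%:R).
  exact: is_derive_chain (coord_derive x i j) (pow_derive 2 (x 0 j)).
have hs := @is_derive_sum R _ _ d (fun j (y : 'rV[R]_d) => y 0 j ^+ 2) x (evec R i) _ h.
have -> : 2 * x 0 i = \sum_(j < d) 2 * x 0 j * (j == i)%:R.
  rewrite (bigD1 i)//= eqxx mulr1 big1 ?addr0// => j /negbTE ->; by rewrite mulr0.
by apply: eq_is_derive hs => y; rewrite fct_sumE.
Qed.

Variable rho : R.

Definition gap (x : 'rV[R]_d) : R := rho ^+ 2 - \sum_(j < d) x 0 j ^+ 2.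
(** The third power is the least integer power for which the positive part becomes C^2. *)
Definition bumpf (x : 'rV[R]_d) : R := Num.max (gap x) 0 ^+ 3.

Lemma gap_cont : continuous gap.
Proof. by move=> x; apply: contB; [exact: cont_cst|exact: cont_sq]. Qed.

Lemma pgap_cont n : continuous (fun x => Num.max (gap x) 0 ^+ n).
Proof.
move=> x; elim: n => [|n IH]; first exact: cont_cst.
apply: (@cont_near_eq _ _ (fun y => Num.max (gap y) 0 * Num.max (gap y) 0 ^+ n)).
  by apply: filterE => y; rewrite exprS.
by apply: contM => //; apply: cont_max; [exact: gap_cont|exact: cont_cst].
Qed.

Lemma gap_derive x i : is_derive x (evec R i) gap (- (2 * x 0 i)).
Proof.
have h := is_deriveB (is_derive_cst (rho ^+ 2) x (evec R i)) (sq_derive x i).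
by rewrite sub0r in h; exact: h.
Qed.

Lemma bump_derive x i : is_derive x (evec R i) bumpf (-6 * (Num.max (gap x) 0 ^+ 2 * x 0 i)).
Proof.
have := is_derive_chain (gap_derive x i) (posp_derive 1 (gap x)).
have -> : -6 * (Num.max (gap x) 0 ^+ 2 * x 0 i) = 3%:R * Num.max (gap x) 0 ^+ 2 * - (2 * x 0 i) by ring.
by [].
Qed.

Lemma bump_partial i : partial i bumpf = fun x => -6 * (Num.max (gap x) 0 ^+ 2 * x 0 i).
Proof. by apply/funext => x; have h := bump_derive x i; rewrite /partial derive_val. Qed.

Lemma bump_derive2 x i : is_derive x (evec R i) (partial i bumpf)
  (24 * Num.max (gap x) 0 * x 0 i ^+ 2 - 6 * Num.max (gap x) 0 ^+ 2).
Proof.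
rewrite bump_partial.
have h1 := is_derive_chain (gap_derive x i) (posp_derive 0 (gap x)).
have h2 := is_deriveM h1 (coord_derive x i i).
have h3 := is_deriveZ (-6) h2.
have E : -6 *: (Num.max (gap x) 0 ^+ 2 *: (i == i)%:R +
   x 0 i *: (2%:R * Num.max (gap x) 0 ^+ 1 * - (2 * x 0 i))) =
   24 * Num.max (gap x) 0 * x 0 i ^+ 2 - 6 * Num.max (gap x) 0 ^+ 2.
  by rewrite eqxx /GRing.scale/= expr1; ring.
by rewrite -E; exact: h3.
Qed.

Lemma bump_C2 (x : 'rV[R]_d) i : [/\ derivable bumpf x (evec R i), continuous_at x (partial i bumpf),
  derivable (partial i bumpf) x (evec R i) & continuous_at x (partial i (partial i bumpf))].
Proof.
split; first by case: (bump_derive x i).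
- rewrite bump_partial; apply: contM; first exact: cont_cst.
  by apply: contM; [exact: pgap_cont|exact: cont_coord].
- by case: (bump_derive2 x i).
- have -> : partial i (partial i bumpf) =
      fun x => 24 * Num.max (gap x) 0 ^+ 1 * (x 0 i * x 0 i) - 6 * Num.max (gap x) 0 ^+ 2.
    by apply/funext => y; have h := bump_derive2 y i; rewrite {1}/partial derive_val expr1 -expr2.
  apply: contB.
    apply: contM; last by apply: contM; exact: cont_coord.
    by apply: contM; [exact: cont_cst|exact: pgap_cont].
  by apply: contM; [exact: cont_cst|exact: pgap_cont].
Qed.

(* [Lam] is where the discriminant of
   [24 rho^2 - (24 + B) g + Lam g^2] in [g] vanishes. *)
Lemma bump_subsolution (V : 'rV[R]_d -> R) (B : R) (x : 'rV[R]_d) : 0 < rho -> 0 <= B ->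
  `|6 * d%:R - 6 * \sum_(i < d) x 0 i * partial i V x| <= B ->
  - ((24 + B) ^+ 2 / (96 * rho ^+ 2)) * bumpf x <= laplacian bumpf x - grad_dot V bumpf x.
Proof.
move=> rho0 B0 HB; set g := Num.max (gap x) 0.
set S := \sum_(i < d) x 0 i * partial i V x in HB.
have EL : laplacian bumpf x = 24 * g * (\sum_(i < d) x 0 i ^+ 2) - 6 * d%:R * g ^+ 2.
  rewrite /laplacian (eq_bigr (fun i => 24 * g * x 0 i ^+ 2 - 6 * g ^+ 2)); last first.
    by move=> i _; have h := bump_derive2 x i; rewrite {1}/partial derive_val.
  by rewrite sumrB -mulr_sumr sumr_const card_ord -mulr_natr; ring.
have EG : grad_dot V bumpf x = -6 * g ^+ 2 * S.
  rewrite /grad_dot /S mulr_sumr; apply: eq_bigr => i _; rewrite bump_partial -/g; ring.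
rewrite EL EG /bumpf -/g.
have [gx|gx] := leP (gap x) 0; first by rewrite /g max_r// !expr0n/= !mulr0 !mul0r !subr0.
have gE : g = gap x by rewrite /g max_l// ltW.
have g0 : 0 < g by rewrite gE.
have -> : \sum_(i < d) x 0 i ^+ 2 = rho ^+ 2 - g by rewrite gE /gap subKr.
move: HB; rewrite ler_norml => /andP[_ HB].
set Lam := _ / _.
have r2 : 0 < rho ^+ 2 by rewrite exprn_gt0.
(* Once [6 d - 6 S] is replaced by its bound [B], the required inequality is this quadratic one
   multiplied by [g]. *)
have disc : 0 <= 24 * rho ^+ 2 - (24 + B) * g + Lam * g ^+ 2.
  have -> : 24 * rho ^+ 2 - (24 + B) * g + Lam * g ^+ 2 =
      (48 * rho ^+ 2 - (24 + B) * g) ^+ 2 / (96 * rho ^+ 2).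
    by rewrite /Lam; field; rewrite gt_eqF.
  by rewrite divr_ge0 ?sqr_ge0// mulr_ge0// ltW.
have h1 : 0 <= g * (24 * rho ^+ 2 - (24 + B) * g + Lam * g ^+ 2) by rewrite mulr_ge0// ltW.
have h2 : 0 <= g ^+ 2 * (B - (6 * d%:R - 6 * S)) by rewrite mulr_ge0 ?sqr_ge0// subr_ge0.
rewrite -subr_ge0.
have -> : 24 * g * (rho ^+ 2 - g) - 6 * d%:R * g ^+ 2 - -6 * g ^+ 2 * S - - Lam * g ^+ 3 =
  g * (24 * rho ^+ 2 - (24 + B) * g + Lam * g ^+ 2) + g ^+ 2 * (B - (6 * d%:R - 6 * S)) by ring.
exact: addr_ge0.
Qed.

Lemma bump_ge0 x : 0 <= bumpf x.
Proof. by rewrite /bumpf exprn_ge0// le_max lexx orbT. Qed.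

Lemma bump_out x : 0 <= rho -> rho <= enorm x -> bumpf x = 0.
Proof.
move=> r0 rx; rewrite /bumpf max_r ?expr0n// /gap -sqr_enorm subr_le0.
by rewrite ler_pXn2r// nnegrE enorm_ge0.
Qed.

Lemma bump_tame (r : R) : 0 <= rho -> rho < r -> tame r bumpf.
Proof.
move=> r0 rr x nbx.
have rx : rho < enorm x by apply: (lt_le_trans rr); rewrite leNgt; apply/negP.
apply: filterS (@cont_near_gt R _ (@enorm R d) x rho (@enorm_cont R d x) rx) => y ry.
by rewrite bump_out// ltW.
Qed.

End Bump.

(** * Moments of the solution *)

Lemma near_fst (X Y : topologicalType) (P : X -> Prop) (x : X) (y : Y) :
  (\forall x' \near x, P x') -> \forall z \near (x, y), P z.1.
Proof. by move=> h; have c : z.1 @[z --> (x, y)] --> x := cvg_fst; exact: c _ h. Qed.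

Section Entropy.
Variables (R : realType) (d : nat) (V : 'rV[R]_d -> R) (lam beta r T : R).
Variables (vs : 'rV[R]_d -> R) (mu : 'rV[R]_d -> R -> R).
Hypotheses (dV : forall x i, derivable V x (evec R i)) (cV : continuous V).
Hypothesis cdV : forall i, continuous (partial i V).
Hypothesis tot : iint (fun x => (dens V x)%:E) = 1%E.
Hypotheses (lam0 : 0 < lam) (poin : poincare V lam).
Hypotheses (beta0 : 0 < beta) (r0 : 0 < r) (T0 : 0 < T).
Hypothesis mass0 : pint V (oball r) (fun x => `|vs x|) = 1%E.
Hypothesis vs_gt0 : forall x, oball r x -> 0 < vs x.
Hypothesis sol : classical_solution V beta r T vs mu.

Let w := dens V.
Let cw : continuous w := dens_cont cV.
Let w_gt0 x : 0 < w x := expR_gt0 _.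
Let w0 x : 0 <= w x := ltW (w_gt0 x).
Let r0' : 0 <= r := ltW r0.
Let A := 2 * r.
Let A0 : 0 <= A.
Proof. by rewrite /A mulr_ge0. Qed.
Let rA : r <= A.
Proof. by rewrite /A mulr_natl mulr2n lerDl. Qed.
Let u := ext r T mu.
Let u_ge0 x t : 0 <= u x t := ext_ge0 T0 sol x t.
Let u_out x t : ~ oball r x -> u x t = 0 := @ext_out R d r T mu x t.

Let u_in x t : cball r x -> 0 <= t <= T -> u x t = mu x t := @ext_in R d V beta r T vs mu sol x t.

(** A compactly supported substitute for the constant 1: it is 1 on the ball and vanishes beyond
    radius [2 * r], whence the choice of the common box [A]. *)
Definition plateau (x : 'rV[R]_d) : R := Num.max 0 (Num.min 1 (2 - enorm x / r)).

Lemma plateau_ge0 x : 0 <= plateau x.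
Proof. by rewrite /plateau le_max lexx. Qed.

Lemma plateau1 x : oball r x -> plateau x = 1.
Proof.
move=> xr; have h : 1 <= 2 - enorm x / r.
  have : enorm x / r <= 1 by rewrite ler_pdivrMr// mul1r ltW.
  lra.
by rewrite /plateau min_l// max_r.
Qed.

Lemma plateau_Cc : Cc A plateau.
Proof.
split => [x|x [i ri]].
  apply: cont_max; first exact: cont_cst.
  apply: cont_min; first exact: cont_cst.
  apply: contB; first exact: cont_cst.
  by apply: contM; [exact: enorm_cont|exact: cont_cst].
have h : 2 <= enorm x / r.
  by rewrite ler_pdivlMr//; apply: le_trans (coord_le_enorm x i); exact: ltW.
by rewrite /plateau min_r ?max_l//; lra.
Qed.

Lemma I_plateau : I w plateau <= 1.
Proof.
have C := Cc_mulr plateau_Cc cw.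
rewrite -lee_fin -(iint_J A0 C) -tot; apply: le_iint => x; rewrite /= lee_fin.
  by rewrite mulr_ge0// plateau_ge0.
by rewrite ler_piMl// /plateau ge_max ler01 ge_min lexx.
Qed.

Let uC t : Cc A (u ^~ t) := Cc_le rA (ext_Cc T0 sol t).

Let u_cont : continuous (fun z : 'rV[R]_d * R => u z.1 z.2) := ext_cont T0 sol.

Definition moment (p t : R) : R := I w (fun x => u x t `^ p).

Lemma u_powR_Cc p t : 0 < p -> Cc A (fun x => u x t `^ p).
Proof. by move=> p0; exact: (Cc_powR p0 (uC t) (u_ge0 ^~ t)). Qed.

Lemma pint_moment p t : 0 < p -> 0 <= t <= T ->
  pint V (oball r) (fun x => mu x t `^ p) = (moment p t)%:E.
Proof.
move=> p0 tT; rewrite -(iint_J A0 (Cc_mulr (u_powR_Cc t p0) cw)).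
rewrite /pint /iint_on; congr iint; apply/funext => x /=.
case: ifPn => /asboolP bx; first by rewrite u_in//; exact: ltW.
by rewrite u_out// powR0 ?gt_eqF// mul0r.
Qed.

Lemma pint_moment_norm p t : 0 < p -> 0 <= t <= T ->
  pint V (oball r) (fun x => `|mu x t| `^ p) = (moment p t)%:E.
Proof.
move=> p0 tT; rewrite -pint_moment// /pint /iint_on; congr iint; apply/funext => x /=.
case: ifPn => // /asboolP bx; have [mu0 _] := sol.
by rewrite ger0_norm//; apply: mu0 => //; exact: ltW.
Qed.

Lemma mass_init : I w (u ^~ 0) = 1.
Proof.
have tT : 0 <= (0 : R) <= T by rewrite lexx/= ltW.
suff : (I w (u ^~ 0))%:E = 1%E by case.
rewrite -mass0 -(iint_J A0 (Cc_mulr (uC 0) cw)).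
rewrite /pint /iint_on; congr iint; apply/funext => x /=.
case: ifPn => /asboolP bx; last by rewrite u_out// mul0r.
have [_ [_ [_ [_ [ini _]]]]] := sol.
have bc : cball r x by exact: ltW.
by rewrite u_in// ini// gtr0_norm//; exact: vs_gt0.
Qed.

Lemma comp_cont (g : R -> R) : continuous g -> g 0 = 0 -> continuous (fun t => I w (fun x => g (u x t))).
Proof.
move=> cg g0 t.
apply: (@J_cvg R d A R (fun x s => g (u x s) * w x) t A0).
  by move=> s; apply: (Cc_mulr _ cw); exact: Cc_comp.
move=> x; apply: contM.
  by apply: (@cont_comp _ _ _ (fun z : 'rV[R]_d * R => u z.1 z.2) g); [exact: u_cont|exact: cg].
by apply: (@cont_comp _ _ _ (fun z : 'rV[R]_d * R => z.1) w); [exact: cvg_fst|exact: cw].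
Qed.

Lemma moment_cont p : 0 < p -> continuous (moment p).
Proof.
move=> p0 t; have := @comp_cont (fun s => `|s| `^ p) (cont_abs_powR p0).
rewrite normr0 powR0 ?gt_eqF// => /(_ erefl t).
have -> : (fun t => I w (fun x => `|u x t| `^ p)) = moment p by
  apply/funext => s; rewrite /moment; congr (I w); apply/funext => x; rewrite ger0_norm.
by [].
Qed.

(** [E] integrates [Phi (u)] and has derivative [- c] times the Dirichlet integral of [h (u)]. The
    Poincare inequality is applied to [h (u)], which is C^1 on the whole space, and its variance is
    compared with that of the untruncated power. *)
Lemma approx_energy p e : 1 < p -> 0 < e -> exists E E' : R -> R,
  [/\ continuous E, forall t, moment p t - e <= E t <= moment p t &
     forall t, 0 < t < T -> [/\ is_derive t (1 : R) E (E' t), E' t <= 0 &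
       E' t <= - (4 * p * (p - 1) / (p + beta) ^+ 2 * lam *
         (moment (p + beta) t - moment ((p + beta) / 2) t ^+ 2 - e))]].
Proof.
move=> p1 e0.
have p0 : 0 < p by exact: lt_trans p1.
set q := p + beta; have q0 : 0 < q by exact: addr_gt0.
have q20 : 0 < q / 2 by rewrite divr_gt0.
have [B B1 HB] := ext_bounded T0 sol.
have B0 : 0 < B by exact: lt_le_trans B1.
pose H := B `^ (q / 2).
have H0 : 0 <= H by exact: powR_ge0.
have H1 : 0 < 2 * H + 1 by lra.
(* [e' <= e] controls the error of [Phi]; [e' * (2 * H) <= e] controls [u ^ q - h ^ 2], the product
   of a difference at most [e'] and a sum at most [2 * H]. *)
pose e' := e / (2 * H + 1).
have e'0 : 0 < e' by rewrite divr_gt0.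
have e'e : e' <= e.
  by rewrite ler_pdivrMr//; have := mulr_ge0 (ltW e0) H0; lra.
have e'H : e' * (2 * H) <= e.
  by rewrite /e' mulrAC ler_pdivrMr// ler_pM2l//; lra.
have [dl [Phi [phi [phi' [h [h' [dl0 van [cphi' ch'] [dPhi dphi dh] [alg bPhi bh]]]]]]]] :=
  truncation p1 beta0 B0 e'0.
rewrite -/q in alg bh.
set c := 4 * p * (p - 1) / q ^+ 2 in alg *.
have c0 : 0 <= c.
  by rewrite divr_ge0 ?sqr_ge0// mulr_ge0 ?subr_ge0 ?(ltW p1)// mulr_ge0// ltW.
have [Phi00 _ _ h00 _] := van 0 (ltW dl0).
have cPhi : continuous Phi by move=> s; exact: is_derive_cont (dPhi s).
have ch : continuous h by move=> s; exact: is_derive_cont (dh s).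
have CPhi t : Cc A (fun x => Phi (u x t)) by exact: (Cc_comp (uC t) cPhi Phi00).
have Ch t : Cc A (fun x => h (u x t)) by exact: (Cc_comp (uC t) ch h00).
pose E t := I w (fun x => Phi (u x t)).
pose G t := J (fun x => grad_sq (fun y => h (u y t)) x * w x).
have uB x t : 0 <= u x t <= B by rewrite u_ge0 HB.
exists E, (fun t => - (c * G t)); split.
- exact: comp_cont.
- move=> t; apply/andP; split; last first.
    apply: (le_I A0 cw w0 (CPhi t) (u_powR_Cc t p0)) => x.
    by have /andP[] := bPhi _ (uB x t).
  have CL := Cc_lin (- e') plateau_Cc (u_powR_Cc t p0).
  apply: (@le_trans _ _ (I w (fun x => - e' * plateau x + u x t `^ p))).
    rewrite (I_lin A0 cw (- e') plateau_Cc (u_powR_Cc t p0)) [leRHS]addrC lerD2l mulNr lerN2.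
    apply: le_trans e'e; rewrite ler_piMr ?I_plateau//; exact: ltW.
  apply: (le_I A0 cw w0 CL (CPhi t)) => x.
  have [bx|nbx] := pselect (oball r x).
    by rewrite plateau1//; have /andP[] := bPhi _ (uB x t); lra.
  rewrite u_out// Phi00 powR0 ?gt_eqF// addr0 mulNr oppr_le0 mulr_ge0 ?plateau_ge0//; exact: ltW.
- move=> t tT.
  have [hE CG] := energy dV cV cdV beta0 r0 T0 sol tT dl0 van cphi' ch' dPhi dphi dh alg.
  have G0 : 0 <= G t.
    apply: (J_ge0 r0' CG) => x; rewrite mulr_ge0// sumr_ge0// => i _; exact: sqr_ge0.
  split; [exact: hE|by rewrite oppr_le0 mulr_ge0|].
  have vh s : s <= dl -> h s = 0 /\ h' s = 0 by move=> /van[].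
  have C1u := trunc_C1 beta0 T0 sol tT dl0 vh dh ch'.
  have Cu2 : Cc A (fun x => h (u x t) ^+ 2).
    by apply: (Cc_comp (Ch t) (fun s => contM (@cont_idR R s) (@cont_idR R s))); rewrite mulr0.
  (* The finiteness condition in the Poincare inequality is with respect to Lebesgue measure, so the
     weight is divided out. *)
  have Cg : Cc r (grad_sq (fun y => h (u y t))).
    have c1 : continuous (fun x => expR (V x)).
      by move=> x; apply: (@cont_comp _ _ _ V expR); [exact: cV|exact: continuous_expR].
    have := Cc_mulr CG c1.
    have -> : (fun x => grad_sq (fun y => h (ext r T mu y t)) x * dens V x * expR (V x)) =
        grad_sq (fun y => h (u y t)).
      by apply/funext => x; rewrite /dens -mulrA -expRD addNr expR0 mulr1.
    by [].
  have := poin C1u.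
  have E1 := iint_J A0 Cu2; have E2 := iint_J r0' Cg.
  have pT (g : 'rV[R]_d -> R) a : 0 <= a -> Cc a g -> pint V setT g = (I w g)%:E.
    move=> a0 Cgg; rewrite -(iint_J a0 (Cc_mulr Cgg cw)) /pint /iint_on; congr iint.
    by apply/funext => x /=; rewrite asboolT.
  rewrite [X in (X < _)%E -> _]E1 [X in _ -> (X < _)%E -> _]E2 => /(_ (ltry _) (ltry _)).
  rewrite (pT _ _ A0 Cu2) (pT _ _ A0 (Ch t)) (pT _ _ r0' Cg).
  rewrite -!EFinM -EFinB lee_fin -/(G t) => P.
  have hI2 : moment q t - e <= I w (fun x => h (u x t) ^+ 2).
    have CL := Cc_lin (- e) plateau_Cc (u_powR_Cc t q0).
    apply: (@le_trans _ _ (I w (fun x => - e * plateau x + u x t `^ q))).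
      rewrite (I_lin A0 cw (- e) plateau_Cc (u_powR_Cc t q0)) [leRHS]addrC lerD2l mulNr lerN2.
      by rewrite ler_piMr ?I_plateau//; exact: ltW.
    apply: (le_I A0 cw w0 CL Cu2) => x.
    have [bx|nbx] := pselect (oball r x); last first.
      rewrite u_out// h00 expr0n powR0 ?gt_eqF//= addr0 mulNr oppr_le0 mulr_ge0 ?plateau_ge0//.
      exact: ltW.
    rewrite plateau1//; have [/andP[h1 h2] h3] := bh _ (uB x t).
    have -> : u x t `^ q = (u x t `^ (q / 2)) ^+ 2.
      by rewrite -powR_mulrn ?powR_ge0// -powRrM divfK.
    have sH : u x t `^ (q / 2) <= H by apply: le_powR => //; case/andP: (uB x t).
    have : (u x t `^ (q / 2) - h (u x t)) * (u x t `^ (q / 2) + h (u x t)) <= e' * (2 * H).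
      by apply: ler_pM; lra.
    by rewrite -subr_sqr; lra.
  have hI1 : I w (fun x => h (u x t)) <= moment (q / 2) t.
    apply: (le_I A0 cw w0 (Ch t) (u_powR_Cc t q20)) => x.
    by have [/andP[]] := bh _ (uB x t).
  have hI0 : 0 <= I w (fun x => h (u x t)).
    by apply: (I_ge0 A0 cw w0 (Ch t)) => x; have [] := bh _ (uB x t).
  have sq : I w (fun x => h (u x t)) * I w (fun x => h (u x t)) <= moment (q / 2) t ^+ 2.
    by rewrite expr2; apply: ler_pM.
  rewrite lerN2 -mulrA ler_wpM2l//.
  have : lam * (I w (fun x => h (u x t) ^+ 2) - I w (fun x => h (u x t)) * I w (fun x => h (u x t))) <= G t.
    by rewrite -ler_pdivlMl.
  apply: le_trans; rewrite ler_pM2l//; lra.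
Qed.

(** Each [E] is nonincreasing and within [e] of the moment. *)
Lemma moment_nincr p s t : 1 < p -> 0 <= s -> s <= t -> t <= T -> moment p t <= moment p s.
Proof.
move=> p1 s0 st tT; apply/ler_addgt0Pr => e e0.
have [E [E' [cE bE dE]]] := approx_energy p1 e0.
have inT x : s < x < t -> 0 < x < T.
  by move=> /andP[sx xt]; rewrite (le_lt_trans s0 sx) (lt_le_trans xt tT).
have : E t - E s <= 0 * (t - s).
  apply: (@mvt_le R E E') => //.
  - by move=> x /inT/dE[].
  - exact: continuous_subspaceT.
  - by move=> x /inT/dE[].
have /andP[h1 h2] := bE t; have /andP[h3 h4] := bE s; lra.
Qed.

(** With exponent [1 + e], Bernoulli gives [u <= e + u ^ (1 + e)] on the ball at time [t], and
    boundedness gives [u ^ (1 + e) <= B ^ e * u] at time 0. Monotonicity of the moment in between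
    shows the mass to be at most [B ^ e + e]. *)
Lemma mass_le1 t : 0 <= t <= T -> I w (u ^~ t) <= 1.
Proof.
move=> /andP[t0 tT].
have [B B1 HB] := ext_bounded T0 sol.
have B0 : 0 < B by exact: lt_le_trans B1.
have key e : 0 < e -> I w (u ^~ t) <= expR (e * ln B) + e.
  move=> e0; pose p := 1 + e; have p1 : 1 < p by rewrite ltrDl.
  have p0 : 0 < p by exact: lt_trans p1.
  have b1 : I w (u ^~ t) <= e * I w plateau + moment p t.
    rewrite -(I_lin A0 cw e plateau_Cc (u_powR_Cc t p0)).
    apply: (le_I A0 cw w0 (uC t) (Cc_lin e plateau_Cc (u_powR_Cc t p0))) => x.
    have [bx|nbx] := pselect (oball r x); last first.
      by rewrite u_out// addr_ge0 ?powR_ge0// mulr_ge0 ?plateau_ge0// ltW.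
    rewrite plateau1//; have := bernoulli_powR (u_ge0 x t) (ltW p1).
    have : 0 <= e * u x t by rewrite mulr_ge0// ltW.
    by rewrite /p; lra.
  have b2 : moment p 0 <= expR (e * ln B) * I w (u ^~ 0).
    rewrite -(IZ A0 cw _ (uC 0)).
    have CZ := Cc_lin (expR (e * ln B)) (uC 0) (@Cc0 R d A).
    apply: (le_I A0 cw w0 (u_powR_Cc 0 p0)).
      by move: CZ; under eq_fun do rewrite addr0.
    move=> x; have [ux|ux] := eqVneq (u x 0) 0; first by rewrite ux powR0 ?gt_eqF// mulr0.
    have up : 0 < u x 0 by rewrite lt_neqAle eq_sym ux u_ge0.
    rewrite /p powRDp// powRr1 ?(ltW up)// mulrC ler_pM2r//.
    have -> : expR (e * ln B) = B `^ e by rewrite /powR gt_eqF.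
    by apply: le_powR => //; exact: HB.
  have b3 := moment_nincr p1 (lexx 0) t0 tT.
  rewrite mass_init mulr1 in b2.
  have b4 : e * I w plateau <= e by rewrite ler_piMr ?I_plateau// ltW.
  lra.
rewrite leNgt; apply/negP => gt1.
have cg : continuous_at (0 : R) (fun e => expR (e * ln B) + e).
  apply: contD; last exact: cont_idR.
  apply: (@cont_comp R R R (fun e => e * ln B) expR 0); last exact: continuous_expR.
  by apply: contM; [exact: cont_idR|exact: cont_cst].
have : \forall e \near (0 : R), expR (e * ln B) + e < I w (u ^~ t).
  by apply: (cont_near_lt cg); rewrite mul0r expR0 addr0.
move=> /nbhs_ballP[z /= z0 hz].
have z2 : 0 < z / 2 by rewrite divr_gt0.
have := key _ z2.
rewrite leNgt => /negP; apply; apply: hz.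
by rewrite /ball/= sub0r normrN gtr0_norm ?divr_gt0//; lra.
Qed.


(** The superlevel set of the initial datum is compact and avoids the sphere. The level 1/2 is
    chosen because the weight has mass at most 1, so points below it carry at most half of the
    initial mass. *)
Lemma init_level : exists rho : R, [/\ 0 <= rho, rho < r & forall x, 1 / 2 <= u x 0 -> enorm x <= rho].
Proof.
pose K := (box r : set 'rV[R]_d) `&` ((u ^~ 0) @^-1` [set y | 1 / 2 <= y]).
have cK : compact K.
  apply: compact_closedI; first exact: box_compact.
  apply: closed_comp; last exact: closed_ge.
  by move=> x _; exact: (uC 0).1.
have inK x : 1 / 2 <= u x 0 -> oball r x /\ K x.
  move=> h; have bx : oball r x.
    by apply: contrapT => /(u_out 0) h'; move: h; rewrite h'; lra.
  split => //; split => //= i; exact: le_trans (coord_le_enorm x i) (ltW bx).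
have [[x0 Kx0]|nK] := pselect (exists x, K x); last first.
  by exists 0; split => // x /inK[_ Kx]; case: nK; exists x.
have [||c cK' cmax] := @EVT_max_rV R d (@enorm R d) K _ cK.
- by exists x0.
- by apply: continuous_subspaceT; exact: enorm_cont.
exists (enorm c); split; first exact: enorm_ge0.
  by move: cK'; rewrite inE => -[_ /= /inK[]].
by move=> x /inK[_ Kx]; apply: cmax; rewrite inE.
Qed.

Lemma W_cont t x : 0 < t < T -> oball r x -> continuous_at x (fun y => mu y t `^ (beta + 1)).
Proof.
move=> tT bx; have m0 : 0 < beta + 1 by exact: addr_gt0.
apply: (@cont_near_eq _ _ (fun y => u y t `^ (beta + 1))); last exact: (u_powR_Cc t m0).1.
by apply: filterS (oball_near bx) => y yr; rewrite /u (ext_mu sol tT).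
Qed.

(* Testing the equation against a compactly supported subsolution [bumpf] of
   [L phi >= - Lam phi] rules out extinction in finite time. *)
Lemma mass_gt0 t : 0 <= t <= T -> 0 < I w (u ^~ t).
Proof.
move=> tT.
have [rho' [rho'0 rho'r hrho']] := init_level.
(* Strictly between the two radii: the bump is bounded below on the ball of radius [rho'] and
   vanishes near the sphere of radius [r]. *)
pose rho := (rho' + r) / 2.
have rho0 : 0 < rho by rewrite /rho; lra.
have rhor : rho < r by rewrite /rho; lra.
have rho'rho : rho' < rho by rewrite /rho; lra.
pose phi : 'rV[R]_d -> R := bumpf rho.
have phi0 x : 0 <= phi x by exact: bump_ge0.
have cphi : continuous phi by move=> x; exact: pgap_cont.
have tphi : tame r phi by exact: bump_tame (ltW rho0) rhor.
have phi_out x : ~ oball r x -> phi x = 0 by move=> /tphi/nbhs_singleton.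
pose G s := I w (fun x => u x s * phi x).
have CG s : Cc A (fun x => u x s * phi x) by exact: Cc_mulr.
(* [c0] is a lower bound for the bump on the ball of radius [rho']. Splitting at the level 1/2 and
   integrating gives [c0 <= c0 / 2 + G 0]. *)
have G0 : 0 < G 0.
  pose c0 := (rho ^+ 2 - rho' ^+ 2) ^+ 3.
  have gap0 : 0 < rho ^+ 2 - rho' ^+ 2 by rewrite subr_gt0 ltr_pXn2r// nnegrE ltW.
  have c00 : 0 < c0 by rewrite exprn_gt0.
  have CL := Cc_lin (c0 / 2) plateau_Cc (CG 0).
  have CZ : Cc A (fun x => c0 * u x 0).
    by have := Cc_lin c0 (uC 0) (@Cc0 R d A); under eq_fun do rewrite addr0.
  have : I w (fun x => c0 * u x 0) <= I w (fun x => c0 / 2 * plateau x + u x 0 * phi x).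
    apply: (le_I A0 cw w0 CZ CL) => x.
    have [h|h] := leP (1 / 2) (u x 0).
      have : c0 * u x 0 <= u x 0 * phi x.
        rewrite mulrC ler_wpM2l// /phi /bumpf /c0.
        have gx : rho ^+ 2 - rho' ^+ 2 <= gap rho x.
          by rewrite /gap lerD2l lerN2 -sqr_enorm ler_pXn2r ?nnegrE ?enorm_ge0// hrho'.
        have gm : rho ^+ 2 - rho' ^+ 2 <= Num.max (gap rho x) 0 by rewrite le_max gx.
        by rewrite ler_pXn2r// nnegrE ?(ltW gap0)// (le_trans (ltW gap0)).
      have : 0 <= c0 / 2 * plateau x by rewrite mulr_ge0 ?plateau_ge0// divr_ge0// ltW.
      lra.
    have [bx|nbx] := pselect (oball r x); last first.
      by rewrite u_out// mulr0 mul0r addr0 mulr_ge0 ?plateau_ge0// divr_ge0// ltW.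
    rewrite plateau1// mulr1.
    have : c0 * u x 0 <= c0 * (1 / 2) by rewrite ler_wpM2l// ltW.
    by have := mulr_ge0 (u_ge0 x 0) (phi0 x); lra.
  rewrite (IZ A0 cw _ (uC 0)) mass_init (I_lin A0 cw _ plateau_Cc (CG 0)) -/(G 0).
  have : c0 / 2 * I w plateau <= c0 / 2 by rewrite ler_piMr ?I_plateau// divr_ge0// ltW.
  lra.
have [B B1 HB] := ext_bounded T0 sol.
have B0 : 0 < B by exact: lt_le_trans B1.
pose S x := 6 * d%:R - 6 * \sum_(i < d) (x : 'rV[R]_d) 0 i * partial i V x.
have cS : continuous S.
  move=> x; apply: contB; first exact: cont_cst.
  apply: contM; first exact: cont_cst.
  by apply: cont_sum => i; apply: contM; [exact: cont_coord|exact: cdV].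
have cSK : {within (box r : set 'rV[R]_d), continuous S} by exact: continuous_subspaceT.
have [N [_ HN]] := compact_bounded (continuous_compact cSK (@box_compact R d r)).
pose Bd := Num.max 0 (N + 1).
have Bd0 : 0 <= Bd by rewrite le_max lexx.
have HS x : oball r x -> `|S x| <= Bd.
  move=> bx; rewrite le_max; apply/orP; right.
  apply: (HN (N + 1)); first by rewrite ltrDl.
  by exists x => // i; exact: le_trans (coord_le_enorm x i) (ltW bx).
pose Lam := (24 + Bd) ^+ 2 / (96 * rho ^+ 2).
have Lam0 : 0 <= Lam by rewrite divr_ge0 ?sqr_ge0// mulr_ge0// sqr_ge0.
have m0 : 0 < beta + 1 by exact: addr_gt0.
(* The rate in [G' >= - kap G]: the subsolution property gives [Lam], and
   [u ^ (beta + 1) <= B ^ beta * u]. *)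
pose kap := (1 + beta)^-1 * (Lam * B `^ beta).
pose F (x : 'rV[R]_d) s := u x s * phi x * w x.
pose F' (x : 'rV[R]_d) s := derive1 (mu x) s * phi x * w x.
have dG s : 0 < s < T -> is_derive s (1 : R) G (J (F' ^~ s)) /\ - (kap * G s) <= J (F' ^~ s).
  move=> sT.
  have CF z : Cc A (F ^~ z) by exact: Cc_mulr.
  have cF' x : continuous_at (x, s) (fun z : 'rV[R]_d * R => F' z.1 z.2).
    have [bx|nbx] := pselect (oball r x).
      have [_ [_ [H _]]] := sol; have [_ [hc _]] := H x s bx sT.
      apply: contM; last by apply: (@cont_comp _ _ _ (fun z : 'rV[R]_d * R => z.1) w); [exact: cvg_fst|exact: cw].
      apply: contM; first exact: hc.
      by apply: (@cont_comp _ _ _ (fun z : 'rV[R]_d * R => z.1) phi); [exact: cvg_fst|exact: cphi].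
    apply: (@cont_near_eq _ _ (fun=> 0)); last exact: cont_cst.
    have n1 : \forall z \near (x, s), phi z.1 = 0 by exact: (near_fst s (tphi x nbx)).
    by apply: filterS n1 => z z0; rewrite /F' z0 mulr0 mul0r.
  have CF' : Cc A (F' ^~ s).
    split => [x|x [i ri]].
      exact: (@cont_fst _ _ _ (fun z : 'rV[R]_d * R => F' z.1 z.2) x s (cF' x)).
    rewrite /F' phi_out ?mulr0 ?mul0r//; apply: (@out_oball R d r x i).
    exact: le_lt_trans rA ri.
  have [e0 e00 he0] := near_time sT.
  have dF x z : `|z - s| < e0 -> is_derive z (1 : R) (F x) (F' x z).
    move=> /he0 zT; have [bx|nbx] := pselect (oball r x).
      have h1 := ext_time_derive sol bx zT.
      have h2 := is_deriveZ (phi x * w x) h1.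
      rewrite /F' -mulrA mulrC; apply: eq_is_derive h2 => y.
      by rewrite /F -[RHS]mulrA [RHS]mulrC.
    rewrite /F' phi_out// mulr0 mul0r.
    by apply: (@zero_is_derive R R^o) => y; rewrite /F phi_out// mulr0 mul0r.
  split; first exact: (J_deriv A0 e00 CF CF' dF cF').
  pose W (y : 'rV[R]_d) : R := mu y s `^ (beta + 1).
  have C2 := fun x i => @bump_C2 R d rho x i.
  (* Integration by parts is used twice, with the roles of [phi] and [W] exchanged, to move the
     whole operator onto [phi]. *)
  have [|||D1 D2 E1] := @ibp R d r V dV cV cdV phi W _ _ _ r0'.
  - move=> x bx; split; first exact: cphi.
    by move=> i; have [c1 c2 _ _] := C2 x i; split; [exact: c1|exact: c2].
  - by move=> x bx i; exact: (W_C2 sol sT).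
  - by move=> x nbx; left; exact: tphi.
  have [|||D3 D4 E2] := @ibp R d r V dV cV cdV W phi _ _ _ r0'.
  - move=> x bx; split; first exact: W_cont.
    by move=> i; have [c1 c2 _ _] := W_C2 sol sT i bx; split; [exact: c1|exact: c2].
  - by move=> x bx i; exact: C2.
  - by move=> x nbx; right; exact: tphi.
  have EF : F' ^~ s = fun x => (1 + beta)^-1 * (phi x * (laplacian W x - grad_dot V W x) * w x).
    apply/funext => x; rewrite /F'.
    have [bx|nbx] := pselect (oball r x).
      have [_ [_ [_ [pde _]]]] := sol; rewrite (pde x s bx sT) -/W; ring.
    by rewrite phi_out// mulr0 !mul0r mulr0.
  have Esym : (fun x => grad_dot phi W x * dens V x) = (fun x => grad_dot W phi x * dens V x).
    by apply/funext => x; congr (_ * _); apply: eq_bigr => i _; rewrite mulrC.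
  rewrite EF (JZ _ r0' D1) E1 Esym -E2 /kap -mulrA -mulrN.
  apply: ler_wpM2l; first by rewrite invr_ge0 addr_ge0// ltW.
  have CGw := Cc_mulr (CG s) cw.
  have CN : Cc A (fun x => - (Lam * B `^ beta) * (u x s * phi x * w x)).
    have := Cc_lin (- (Lam * B `^ beta)) CGw (@Cc0 R d A).
    by under eq_fun do rewrite addr0.
  rewrite -mulNr -(JZ (- (Lam * B `^ beta)) A0 CGw).
  apply: (le_J A0 CN (Cc_le rA D3)) => x.
  rewrite [_ * (_ * _ * _)]mulrA; apply: ler_wpM2r; first exact: w0.
  have [bx|nbx] := pselect (oball r x); last first.
    rewrite phi_out// !mulr0.
    have gx : gap rho x <= 0.
      rewrite /gap -sqr_enorm subr_le0 ler_pXn2r ?nnegrE ?enorm_ge0 ?(ltW rho0)//.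
      by apply: (le_trans (ltW rhor)); rewrite leNgt; apply/negP.
    have -> : laplacian phi x = 0.
      rewrite /laplacian big1// => i _; have h := bump_derive2 rho x i.
      by rewrite {1}/partial derive_val max_r// !expr0n/= !mulr0 mul0r subr0.
    have -> : grad_dot V phi x = 0.
      by rewrite /grad_dot big1// => i _; rewrite bump_partial max_r// expr0n/= mul0r !mulr0.
    by rewrite subr0 mulr0.
  have hL := @bump_subsolution R d rho V Bd x rho0 Bd0 (HS x bx).
  rewrite -/Lam -/phi in hL.
  have W0 : 0 <= W x by exact: powR_ge0.
  have WB : W x <= B `^ beta * u x s.
    rewrite /W -(ext_mu sol sT bx) -/(u x s).
    have [->|ux] := eqVneq (u x s) 0; first by rewrite powR0 ?gt_eqF// mulr0.
    have up : 0 < u x s by rewrite lt_neqAle eq_sym ux u_ge0.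
    rewrite powRDp// powRr1 ?(ltW up)// ler_pM2r//; apply: le_powR => //; exact: HB.
  apply: (@le_trans _ _ (W x * (- Lam * phi x))); last exact: ler_wpM2l.
  have : W x * (Lam * phi x) <= B `^ beta * u x s * (Lam * phi x).
    by apply: ler_wpM2r => //; rewrite mulr_ge0.
  by lra.
have cG : continuous G.
  move=> s; apply: (@J_cvg R d A R F s A0).
    by move=> z; exact: Cc_mulr.
  move=> x; apply: contM; last by apply: (@cont_comp _ _ _ (fun z : 'rV[R]_d * R => z.1) w); [exact: cvg_fst|exact: cw].
  apply: contM; first exact: u_cont.
  by apply: (@cont_comp _ _ _ (fun z : 'rV[R]_d * R => z.1) phi); [exact: cvg_fst|exact: cphi].
have dexp (s : R) : is_derive s (1 : R) (fun y => expR (kap * y)) (expR (kap * s) * kap).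
  apply: (@is_derive_chain R R^o (fun y => kap * y) expR).
  have h := is_deriveZ kap (is_derive_id s (1 : R)).
  by rewrite [_ *: _]mulr1 in h; exact: h.
move/andP: tT => [t0 tT].
have Gt : 0 < G t.
  (* [expR (kap * s) * G s] is nondecreasing. *)
  have := @mvt_le R (fun s => - (expR (kap * s) * G s))
    (fun s => - (expR (kap * s) * J (F' ^~ s) + G s * (expR (kap * s) * kap))) 0 t 0 t0.
  rewrite mulr0 expR0 mul1r mul0r opprK => W.
  have : - (expR (kap * t) * G t) + G 0 <= 0.
    apply: W.
    - move=> s /andP[s0 st]; have sT : 0 < s < T by rewrite s0 (lt_le_trans st tT).
      have [h1 _] := dG s sT; have h2 := dexp s.
      by apply: is_deriveN; exact: is_deriveM.
    - apply: within_N; apply: within_M; apply: continuous_subspaceT => //.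
      by move=> s; exact: is_derive_cont (dexp s).
    - move=> s /andP[s0 st]; have sT : 0 < s < T by rewrite s0 (lt_le_trans st tT).
      have [_ h1] := dG s sT; rewrite oppr_le0.
      have : 0 <= expR (kap * s) * (J (F' ^~ s) + kap * G s).
        by rewrite mulr_ge0 ?expR_ge0//; lra.
      by lra.
  move=> h; have : 0 < expR (kap * t) * G t by lra.
  by rewrite pmulr_rgt0// expR_gt0.
(* The bump is at most [rho ^ 6], so positivity passes from [G t] to the mass. *)
have CZ : Cc A (fun x => rho ^+ 2 ^+ 3 * u x t).
  by have := Cc_lin (rho ^+ 2 ^+ 3) (uC t) (@Cc0 R d A); under eq_fun do rewrite addr0.
have : G t <= rho ^+ 2 ^+ 3 * I w (u ^~ t).
  rewrite -(IZ A0 cw _ (uC t)); apply: (le_I A0 cw w0 (CG t) CZ) => x.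
  rewrite mulrC ler_wpM2r// /phi /bumpf.
  have gm : Num.max (gap rho x) 0 <= rho ^+ 2.
    rewrite ge_max sqr_ge0 andbT /gap -sqr_enorm; have := sqr_ge0 (enorm x); lra.
  by rewrite ler_pXn2r// nnegrE ?sqr_ge0// le_max lexx orbT.
move=> h; have := lt_le_trans Gt h; rewrite pmulr_rgt0// !exprn_gt0//.
Qed.

(** With [e] half of the mass, [u <= e + e ^ (1 - p) * u ^ p] on the ball, since [u > e] makes the
    second term at least [u]. Integration leaves at least [e] for the moment term. *)
Lemma moment_gt0 p t : 1 < p -> 0 <= t <= T -> 0 < moment p t.
Proof.
move=> p1 tT; have p0 : 0 < p by exact: lt_trans p1.
have m0 := mass_gt0 tT.
pose e := I w (u ^~ t) / 2.
have e0 : 0 < e by rewrite divr_gt0.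
have CL := Cc_lin e plateau_Cc (Cc_lin (e `^ (1 - p)) (u_powR_Cc t p0) (@Cc0 R d A)).
have : I w (u ^~ t) <= I w (fun x => e * plateau x + (e `^ (1 - p) * u x t `^ p + 0)).
  apply: (le_I A0 cw w0 (uC t) CL) => x; rewrite addr0.
  have h0 : 0 <= e `^ (1 - p) * u x t `^ p by rewrite mulr_ge0 ?powR_ge0.
  have [bx|nbx] := pselect (oball r x); last first.
    by rewrite u_out// addr_ge0// ?mulr_ge0 ?powR_ge0 ?plateau_ge0// ltW.
  rewrite plateau1// mulr1; have [ue|eu] := leP (u x t) e; first by lra.
  have up : 0 < u x t by exact: lt_trans eu.
  have : u x t <= e `^ (1 - p) * u x t `^ p.
    have -> : e `^ (1 - p) * u x t `^ p = u x t * (u x t `^ (p - 1) / e `^ (p - 1)).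
      rewrite -opprB powRN mulrC mulrA; congr (_ / _).
      by rewrite -{2}[u x t]powRr1 ?(ltW up)// -powRDp// addrC subrK.
    rewrite ler_peMr ?(ltW up)// ler_pdivlMr ?powR_gt0// mul1r.
    by apply: le_powR; rewrite ?subr_gt0// ltW.
  by lra.
rewrite (I_lin A0 cw e plateau_Cc) ?(I_lin A0 cw _ (u_powR_Cc t p0) (@Cc0 R d A)); last first.
  exact: Cc_lin (u_powR_Cc t p0) (@Cc0 R d A).
have -> : I w (fun=> 0) = 0.
  by rewrite /I; under eq_fun do rewrite mul0r; exact: (J0 d A0).
rewrite addr0 -/(moment p t).
have : e * I w plateau <= e by rewrite ler_piMr ?I_plateau// ltW.
have E : I w (u ^~ t) = 2 * e by rewrite /e mulrC divfK.
move=> h1 h2; have : 0 < e `^ (1 - p) * moment p t by lra.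
by rewrite pmulr_rgt0// powR_gt0.
Qed.

End Entropy.

(** * Decay of the entropy *)

Lemma within_comp_powR (R : realType) (E : R -> R) (b x y : R) : continuous E ->
  (forall s, x <= s <= y -> 0 < E s) -> {within `[x, y], continuous (fun s => E s `^ b)}.
Proof.
move=> cE E0; apply: continuous_in_subspaceT => s; rewrite inE/= in_itv/= => sxy.
by apply: (@cont_comp R R R E (fun z => z `^ b) s (cE s)); apply: cont_powR; exact: E0.
Qed.

Lemma within_comp_ln (R : realType) (E : R -> R) (x y : R) : continuous E ->
  (forall s, x <= s <= y -> 0 < E s) -> {within `[x, y], continuous (fun s => ln (E s))}.
Proof.
move=> cE E0; apply: continuous_in_subspaceT => s; rewrite inE/= in_itv/= => sxy.
by apply: (@cont_comp R R R E (@ln R) s (cE s)); apply: continuous_ln; exact: E0.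
Qed.

(** * Integration of the two differential inequalities *)

Section Ode.
Variables (R : realType) (p beta lam T : R) (F D : R -> R).
Hypotheses (p1 : 1 < p) (beta0 : 0 < beta) (lam0 : 0 < lam).
Hypothesis Fdec : forall s t, 0 <= s -> s <= t -> t <= T -> F t <= F s.
Hypothesis DF : forall t, 0 <= t <= T -> 1 <= F t ->
  F t `^ ((p + beta) / p) * (1 - expR (- ((p - 1)^-1 * ln (F t)))) <= D t.
Hypothesis approx : forall e, 0 < e -> exists E E' : R -> R,
  [/\ continuous E, forall t, F t - e <= E t <= F t &
     forall t, 0 < t < T -> is_derive t (1 : R) E (E' t) /\
       E' t <= - (4 * p * (p - 1) / (p + beta) ^+ 2 * lam * (D t - e))].

Let p0 : 0 < p := lt_trans ltr01 p1.
Let pm0 : 0 < p - 1.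
Proof. by rewrite subr_gt0. Qed.
Let q := p + beta.
Let q0 : 0 < q := addr_gt0 p0 beta0.
Let K t := (p - 1)^-1 * ln (F t).
Let a := beta / p.
Let a0 : 0 < a := divr_gt0 beta0 p0.
Let c := 4 * p * (p - 1) / q ^+ 2 * lam.
Let c0 : 0 < c.
Proof. by rewrite mulr_gt0// divr_gt0 ?exprn_gt0// !mulr_gt0. Qed.
Let qp : q / p = 1 + a.
Proof. by rewrite /q mulrDl mulfV// gt_eqF. Qed.

Lemma ge_limit (g : R -> R) (b e1 : R) : 0 < e1 -> continuous_at 0 g ->
  (forall e, 0 < e -> e < e1 -> b <= g e) -> b <= g 0.
Proof.
move=> e10 cg H; rewrite leNgt; apply/negP => gb.
have /nbhs_ballP[z /= z0 hz] := cont_near_lt cg gb.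
pose e := Num.min z e1 / 2.
have m0 : 0 < Num.min z e1 by rewrite lt_min z0.
have e0 : 0 < e by rewrite divr_gt0.
have em : e < Num.min z e1 by rewrite /e; lra.
move: em; rewrite lt_min => /andP[ez ee1].
have := H e e0 ee1; rewrite leNgt => /negP; apply; apply: hz.
by rewrite /ball/= sub0r normrN gtr0_norm.
Qed.

(** While [K >= 1], formally [F' <= - (c / 2) F ^ (1 + a)] with [a = beta / p], so [F ^ (- a)] grows
    at rate at least [a c / 2], which is the coefficient of [t] in the bound. The computation is
    carried out for [E]. *)
Lemma fast_decay t : 0 < t -> t <= T -> 1 <= F t -> (forall s, 0 <= s <= t -> 1 <= K s) ->
  K t <= - (p * ln (expR (- (beta * (p - 1) / p) * K 0) +
    2 * beta * lam * (p - 1) / (p + beta) ^+ 2 * t)) / (beta * (p - 1)).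
Proof.
move=> t0 tT Ft1 K1.
have F1 s : 0 <= s <= t -> 1 <= F s.
  by move=> /andP[s0 st]; apply: (le_trans Ft1); exact: Fdec.
have Ft0 : 0 < F t by exact: lt_le_trans Ft1.
have F00 : 0 < F 0 by apply: (lt_le_trans ltr01); apply: F1; rewrite lexx ltW.
(* The accumulated error per unit of [e]: [F >= 1] and [e < 1 / 2] give [E >= 1 / 2], so
   [E ^ (- a - 1)] is at most [2 ^ (a + 1)]. *)
pose L := a * c * t * 2 `^ (a + 1).
have key : F 0 `^ (- a) + a * c / 2 * t <= F t `^ (- a).
  have := @ge_limit (fun e => (F t - e) `^ (- a) + L * e) (F 0 `^ (- a) + a * c / 2 * t) (1 / 2).
  rewrite subr0 mulr0 addr0; apply.
  - by rewrite divr_gt0.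
  - apply: contD; last by apply: contM; [exact: cont_cst|exact: cont_idR].
    apply: (@cont_comp R R R (fun e => F t - e) (fun y => y `^ (- a)) 0).
      by apply: contB; [exact: cont_cst|exact: cont_idR].
    by apply: cont_powR; rewrite subr0.
  move=> e e0 e12; have [E [E' [cE bE dE]]] := approx e0.
  have Eh s : 0 <= s <= t -> 1 / 2 <= E s.
    by move=> /F1 h1; have /andP[h2 _] := bE s; lra.
  have E0 s : 0 <= s <= t -> 0 < E s by move=> /Eh; lra.
  have sub s : 0 < s < t -> 0 <= s <= t /\ 0 < s < T.
    by move=> /andP[s0 st]; rewrite !ltW// s0 (lt_le_trans st tT).
  have := @mvt_le R (fun s => - E s `^ (- a)) (fun s => - (- a * E s `^ (- a - 1) * E' s)) 0 t
     (- (a * c * (1 / 2 - e * 2 `^ (a + 1)))) (ltW t0).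
  rewrite subr0 => W.
  have {}W : - E t `^ (- a) - - E 0 `^ (- a) <= - (a * c * (1 / 2 - e * 2 `^ (a + 1))) * t.
    apply: W.
    - move=> s /sub[st sT]; have [h1 _] := dE s sT.
      have h2 := @is_derive_chain R R^o E (fun y => y `^ (- a)) s 1 _ _ h1 (is_derive1_powR (- a) (E0 s st)).
      exact: is_deriveN.
    - by apply: within_N; exact: within_comp_powR.
    - move=> s /sub[st sT]; have [_ h1] := dE s sT.
      have Es := E0 s st; have Fs := F1 s st.
      have h2 : E s `^ (1 + a) / 2 <= D s.
        have sT' : 0 <= s <= T by case/andP: sT => s1 s2; rewrite !ltW.
        apply: le_trans (DF sT' Fs); rewrite -/q qp.
        have h3 := one_minus_exp_half (K1 s st).
        have h4 : E s `^ (1 + a) <= F s `^ (1 + a).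
          apply: le_powR; [by rewrite addr_gt0|exact: ltW|by have /andP[] := bE s].
        apply: ler_pM => //; [exact: powR_ge0|by move: h3; rewrite /K; lra].
      have -> : - (- a * E s `^ (- a - 1) * E' s) = a * E s `^ (- a - 1) * E' s by ring.
      have P0 : 0 < E s `^ (- a - 1) by rewrite powR_gt0.
      have h5 : E s `^ (- a - 1) <= 2 `^ (a + 1).
        have -> : - a - 1 = - (a + 1) by rewrite opprD.
        have -> : (2 : R) `^ (a + 1) = (2^-1) `^ (- (a + 1)).
          by rewrite -powR_inv1// -powRrM mulN1r opprK.
        rewrite !powRN lef_pV2 ?posrE ?powR_gt0 ?invr_gt0//.
        apply: le_powR; [by rewrite addr_gt0|by rewrite invr_ge0|by have := Eh s st; lra].
      have h6 : E s `^ (- a - 1) * E s `^ (1 + a) = 1.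
        by rewrite -powRDp// (_ : _ + _ = 0) ?powRr0//; ring.
      have h7 : a * E s `^ (- a - 1) * E' s <= a * E s `^ (- a - 1) * - (c * (E s `^ (1 + a) / 2 - e)).
        apply: ler_wpM2l; first by rewrite mulr_ge0 ?powR_ge0// ltW.
        apply: (le_trans h1); rewrite lerN2 -/q -/c; apply: ler_wpM2l; first exact: ltW.
        by rewrite lerB.
      apply: (le_trans h7).
      have -> : a * E s `^ (- a - 1) * - (c * (E s `^ (1 + a) / 2 - e)) =
        - (a * c * (E s `^ (- a - 1) * E s `^ (1 + a) / 2 - e * E s `^ (- a - 1))) by ring.
      rewrite h6 lerN2; apply: ler_wpM2l; first by rewrite mulr_ge0// ltW.
      by rewrite lerB// ler_wpM2l// ltW.
  have tt : 0 <= t <= t by rewrite lexx ltW.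
  have zz : 0 <= (0 : R) <= t by rewrite lexx/= ltW.
  have h1 : E t `^ (- a) <= (F t - e) `^ (- a).
    rewrite !powRN lef_pV2 ?posrE ?powR_gt0 ?(E0 t tt)//; last by lra.
    by apply: le_powR => //; [lra|have /andP[] := bE t].
  have h2 : F 0 `^ (- a) <= E 0 `^ (- a).
    rewrite !powRN lef_pV2 ?posrE ?powR_gt0 ?(E0 0 zz)//.
    by apply: le_powR => //; [exact: ltW (E0 0 zz)|have /andP[] := bE 0].
  rewrite /L; lra.
have E0 : expR (- (beta * (p - 1) / p) * K 0) = F 0 `^ (- a).
  rewrite /powR gt_eqF// /K /a; congr expR.
  by field; rewrite !gt_eqF.
have Ec : 2 * beta * lam * (p - 1) / (p + beta) ^+ 2 * t = a * c / 2 * t.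
  by rewrite /a /c -/q; field; rewrite !gt_eqF.
rewrite E0 Ec.
have L1 : ln (F 0 `^ (- a) + a * c / 2 * t) <= - a * ln (F t).
  rewrite -ln_powR ler_ln ?posrE ?powR_gt0//.
  by rewrite addr_gt0 ?powR_gt0// mulr_gt0// divr_gt0// mulr_gt0.
rewrite ler_pdivlMr ?mulr_gt0// -[leLHS]opprK lerN2.
have -> : - (K t * (beta * (p - 1))) = p * (- a * ln (F t)).
  by rewrite /K /a; field; rewrite !gt_eqF.
by apply: ler_wpM2l => //; exact: ltW.
Qed.

(** For [0 <= K <= 1], formally [K' <= - (p - 1)^-1 c F ^ a K / 2]. Since [F ^ a >= 1] and
    [(p - 1)^-1 c = 2 k], this yields [K' <= - k K], integrated with the factor [expR (k * t)]. *)
Lemma slow_decay t0 t : 0 <= t0 -> t0 <= t -> t <= T -> 1 <= F t -> K t0 <= 1 ->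
  K t <= expR (- (2 * p * lam * (t - t0)) / (p + beta) ^+ 2) * K t0.
Proof.
move=> t00 t0t tT Ft1 Kt0.
have F1 s : t0 <= s <= t -> 1 <= F s.
  move=> /andP[s0 st]; apply: (le_trans Ft1); apply: Fdec => //; exact: le_trans s0.
have Ft0 : 0 < F t by exact: lt_le_trans Ft1.
have ki0 : 0 < (p - 1)^-1 by rewrite invr_gt0.
have K01 s : t0 <= s <= t -> 0 <= K s <= 1.
  move=> st; have Fs := F1 s st; case/andP: (st) => s0 s1; apply/andP; split.
    by rewrite mulr_ge0 ?ln_ge0// ltW.
  apply: le_trans Kt0; rewrite ler_wpM2l ?(ltW ki0)// ler_ln ?posrE.
  - by apply: Fdec => //; exact: le_trans tT.
  - exact: lt_le_trans Fs.
  - by apply: (lt_le_trans ltr01); apply: F1; rewrite lexx.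
pose k := 2 * p * lam / q ^+ 2.
have k0 : 0 < k by rewrite divr_gt0 ?exprn_gt0// !mulr_gt0.
have Ek : (p - 1)^-1 * c = 2 * k by rewrite /c /k; field; rewrite !gt_eqF.
(* The error in the derivative of [kE] is [2 k e / E], at most [4 k e] because [E >= 1 / 2]. *)
pose L := 4 * k * expR (k * T) * (t - t0).
have key : 0 <= expR (k * t0) * K t0 + L * 0 - expR (k * t) * ((p - 1)^-1 * ln (F t - 0)).
  apply: (@ge_limit (fun e => expR (k * t0) * K t0 + L * e - expR (k * t) * ((p - 1)^-1 * ln (F t - e))) 0 (1 / 2)).
  - by rewrite divr_gt0.
  - apply: contB.
      by apply: contD; [exact: cont_cst|apply: contM; [exact: cont_cst|exact: cont_idR]].
    apply: contM; first exact: cont_cst.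
    apply: contM; first exact: cont_cst.
    apply: (@cont_comp R R R (fun e => F t - e) (@ln R) 0).
      by apply: contB; [exact: cont_cst|exact: cont_idR].
    by rewrite subr0; exact: continuous_ln.
  move=> e e0 e12; have [E [E' [cE bE dE]]] := approx e0.
  have Eh s : t0 <= s <= t -> 1 / 2 <= E s.
    by move=> /F1 h1; have /andP[h2 _] := bE s; lra.
  have E0 s : t0 <= s <= t -> 0 < E s by move=> /Eh; lra.
  have sub s : t0 < s < t -> t0 <= s <= t /\ 0 < s < T.
    by move=> /andP[s0 st]; rewrite !ltW// (le_lt_trans t00 s0) (lt_le_trans st tT).
  pose kE s := (p - 1)^-1 * ln (E s).
  pose dkE s := (p - 1)^-1 * ((E s)^-1 * E' s).
  have dexp (s : R) : is_derive s (1 : R) (fun y => expR (k * y)) (expR (k * s) * k).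
    apply: (@is_derive_chain R R^o (fun y => k * y) expR).
    have h := is_deriveZ k (is_derive_id s (1 : R)).
    by rewrite [_ *: _]mulr1 in h; exact: h.
  have := @mvt_le R (fun s => expR (k * s) * kE s) (fun s => expR (k * s) * dkE s + kE s * (expR (k * s) * k)) t0 t
     (4 * k * e * expR (k * T)) t0t.
  move=> W.
  have {}W : expR (k * t) * kE t - expR (k * t0) * kE t0 <= 4 * k * e * expR (k * T) * (t - t0).
    apply: W.
    - move=> s /sub[st sT]; have [h1 _] := dE s sT.
      have h2 := @is_derive_chain R R^o E (@ln R) s 1 _ _ h1 (is_derive1_ln (E0 s st)).
      have h3 : is_derive s (1 : R) kE (dkE s) := is_deriveZ (p - 1)^-1 h2.
      by have h4 := dexp s; exact: is_deriveM.
    - apply: within_M.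
        by apply: continuous_subspaceT => s; exact: is_derive_cont (dexp s).
      by apply: within_M; [exact: within_cst|exact: within_comp_ln].
    - move=> s /sub[st sT]; have [_ h1] := dE s sT.
      have Es := E0 s st; have Fs := F1 s st; have /andP[Ks0 Ks1] := K01 s st.
      have /andP[_ EF] := bE s.
      have sT' : 0 <= s <= T by case/andP: sT => s1 s2; rewrite !ltW.
      have Fs0 : 0 < F s by exact: lt_le_trans Fs.
      have h2 : E s * (kE s / 2) <= D s.
        apply: le_trans (DF sT' Fs); rewrite -/q qp -/(K s).
        have h3 : K s / 2 <= 1 - expR (- K s) by apply: one_minus_exp_lin; rewrite Ks0.
        have h4 : F s <= F s `^ (1 + a).
          by rewrite powRDp// powRr1 ?(ltW Fs0)// ler_peMr ?(ltW Fs0)// -(powRr0 (F s)) ler_powR// ltW.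
        have kK : kE s <= K s by rewrite ler_wpM2l ?(ltW ki0)// ler_ln.
        apply: (@le_trans _ _ (F s * (K s / 2))); last first.
          by apply: ler_pM => //; [exact: ltW|rewrite divr_ge0].
        (* [E] may drop below 1, which makes [kE] negative; the bound is then trivial. *)
        have [kn|kp] := leP (kE s) 0.
          apply: (@le_trans _ _ 0); last by rewrite mulr_ge0 ?(ltW Fs0)// divr_ge0.
          by rewrite pmulr_rle0//; lra.
        by apply: ler_pM => //; [exact: ltW|rewrite divr_ge0// ltW|rewrite ler_pM2r// invr_gt0].
      have h5 : dkE s <= - (k * kE s) + 4 * k * e.
        have hE' : E' s <= - (c * (E s * (kE s / 2) - e)).
          apply: (le_trans h1); rewrite lerN2 -/q -/c; apply: ler_wpM2l; first exact: ltW.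
          by rewrite lerB.
        have Ei : 0 < (E s)^-1 by rewrite invr_gt0.
        have : dkE s <= (p - 1)^-1 * ((E s)^-1 * - (c * (E s * (kE s / 2) - e))).
          by rewrite /dkE; apply: ler_wpM2l; [exact: ltW|apply: ler_wpM2l; [exact: ltW|]].
        have -> : (p - 1)^-1 * ((E s)^-1 * - (c * (E s * (kE s / 2) - e))) =
            (p - 1)^-1 * c * (e * (E s)^-1 - kE s / 2).
          by field; rewrite !gt_eqF.
        rewrite Ek => h6; apply: (le_trans h6).
        have h7 : e * (E s)^-1 <= e * 2.
          rewrite ler_wpM2l ?(ltW e0)// -[leRHS]invrK lef_pV2 ?posrE ?invr_gt0//.
          by have := Eh s st; lra.
        have : 2 * k * (e * (E s)^-1) <= 2 * k * (e * 2) by rewrite ler_wpM2l// mulr_ge0// ltW.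
        lra.
      have h8 : expR (k * s) * dkE s <= expR (k * s) * (- (k * kE s) + 4 * k * e).
        by apply: ler_wpM2l => //; exact: expR_ge0.
      have h9 : expR (k * s) * (4 * k * e) <= expR (k * T) * (4 * k * e).
        apply: ler_wpM2r; first by rewrite mulr_ge0 ?(ltW e0)// mulr_ge0 ?(ltW k0).
        by rewrite ler_expR ler_wpM2l ?(ltW k0)//; case/andP: sT'.
      lra.
  have tt : t0 <= t <= t by rewrite t0t lexx.
  have zz : t0 <= t0 <= t by rewrite lexx.
  have h1 : expR (k * t) * ((p - 1)^-1 * ln (F t - e)) <= expR (k * t) * kE t.
    rewrite ler_wpM2l ?expR_ge0// ler_wpM2l ?(ltW ki0)// ler_ln ?posrE ?(E0 t tt)//.
      by have /andP[] := bE t.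
    by lra.
  have h2 : expR (k * t0) * kE t0 <= expR (k * t0) * K t0.
    rewrite ler_wpM2l ?expR_ge0// ler_wpM2l ?(ltW ki0)// ler_ln ?posrE ?(E0 t0 zz)//.
      by have /andP[] := bE t0.
    by apply: (lt_le_trans ltr01); exact: F1.
  rewrite /L; lra.
have Ee : expR (- (2 * p * lam * (t - t0)) / (p + beta) ^+ 2) = expR (k * t0) / expR (k * t).
  rewrite -expRN -expRD; congr expR; rewrite /k -/q; field; by rewrite gt_eqF.
rewrite Ee mulrAC ler_pdivlMr ?expR_gt0// mulrC.
by move: key; rewrite mulr0 addr0 subr0 subr_ge0.
Qed.

End Ode.

(** * Application to the solution and the threshold time *)

Unset Implicit Arguments.
Set Strict Implicit.

Theorem theorem2 (R : realType) (d : nat) (V : 'rV[R]_d -> R) (lam p beta r T eps2 : R)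
    (vs : 'rV[R]_d -> R) (mu : 'rV[R]_d -> R -> R) :
  smooth V ->
  iint (fun x => (dens V x)%:E) = 1%E ->
  0 < lam -> poincare V lam ->
  1 < p -> 0 < beta -> 2 <= p + beta -> 0 < r -> 0 < T -> 0 < eps2 ->
  smooth_on (oball r) vs ->
  pint V (oball r) (fun x => `|vs x|) = 1%E ->
  (forall x, oball r x -> 0 < vs x <= eps2^-1) ->
  (forall x, sphere r x -> vs x = 0) ->
  classical_solution V beta r T vs mu ->
  let K := fun t => Kp V r p (fun x => mu x t) in
  let t0 := ereal_inf [set t%:E | t in [set t | 0 <= t <= T /\ K t <= 1]] in
  (forall s t, 0 <= s -> s <= t -> t <= T -> K t <= K s) /\
  (forall t, 0 < t <= T -> 1 <= Lpnorm V r p (fun x => mu x t) ->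
     ((t%:E < t0)%E ->
        K t <= - (p * ln (expR (- (beta * (p - 1) / p) * Kp V r p vs)
                          + 2 * beta * lam * (p - 1) / (p + beta) ^+ 2 * t))
               / (beta * (p - 1))) /\
     ((t0 <= t%:E)%E ->
        K t <= expR (- (2 * p * lam * (t - fine t0)) / (p + beta) ^+ 2) * K (fine t0))).
Proof.
move=> sV tot lam0 poin p1 beta0 pb2 r0 T0 _ _ mass0 hvs _ sol K t0.
have dV x i : derivable V x (evec R i) by exact: (sV.1 [::] i x).
have cV : continuous V by exact: (sV.2 [::]).
have cdV i : continuous (partial i V) by exact: (sV.2 [:: i]).
have vs_gt0 x : oball r x -> 0 < vs x by move=> /hvs/andP[].
have p0 : 0 < p by exact: lt_trans p1.
have pm0 : 0 < p - 1 by rewrite subr_gt0.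
pose F := moment V r T mu p.
have KE t : 0 <= t <= T -> K t = (p - 1)^-1 * ln (F t).
  by move=> tT; rewrite /K /Kp (pint_moment cV r0 T0 sol p0 tT).
have F0 t : 0 <= t <= T -> 0 < F t.
  by move=> tT; exact: (moment_gt0 dV cV cdV tot beta0 r0 T0 mass0 vs_gt0 sol).
have Fdec s t : 0 <= s -> s <= t -> t <= T -> F t <= F s.
  exact: (moment_nincr dV cV cdV tot lam0 poin beta0 r0 T0 sol p1).
have Kdec s t : 0 <= s -> s <= t -> t <= T -> K t <= K s.
  move=> s0 st tT; have sT : 0 <= s <= T by rewrite s0 (le_trans st).
  have tT' : 0 <= t <= T by rewrite tT (le_trans s0).
  rewrite !KE// ler_wpM2l ?invr_ge0 ?(ltW pm0)// ler_ln ?posrE ?F0//; exact: Fdec.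
split => // t /andP[tpos tT] hL.
have tT' : 0 <= t <= T by rewrite tT ltW.
pose D s := moment V r T mu (p + beta) s - moment V r T mu ((p + beta) / 2) s ^+ 2.
have DF s : 0 <= s <= T -> 1 <= F s ->
    F s `^ ((p + beta) / p) * (1 - expR (- ((p - 1)^-1 * ln (F s)))) <= D s.
  move=> sT Fs.
  have A0 : 0 <= 2 * r by rewrite mulr_ge0// ltW.
  have uC : Cc (2 * r) (ext r T mu ^~ s).
    by apply: Cc_le (ext_Cc T0 sol s); rewrite mulr_natl mulr2n lerDl ltW.
  have e1 x : ext r T mu x s != 0 -> plateau r x = 1.
    by move=> /eqP nz; apply: plateau1 => //; apply: contrapT => /(ext_out T mu s).
  apply: (variance_lower A0 (dens_cont cV) (fun x => ltW (expR_gt0 _)) uC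
    (fun x => ext_ge0 T0 sol x s) (plateau_Cc d r0) (@plateau_ge0 R d r) e1) => //.
  - exact: I_plateau.
  - by rewrite lerDl ltW.
  - exact: (mass_le1 dV cV cdV tot lam0 poin beta0 r0 T0 mass0 vs_gt0 sol).
have approx e : 0 < e -> exists E E' : R -> R,
    [/\ continuous E, forall t, F t - e <= E t <= F t &
     forall t, 0 < t < T -> is_derive t (1 : R) E (E' t) /\
       E' t <= - (4 * p * (p - 1) / (p + beta) ^+ 2 * lam * (D t - e))].
  move=> e0.
  have [E [E' [cE bE dE]]] := approx_energy dV cV cdV tot lam0 poin beta0 r0 T0 sol p1 e0.
  by exists E, E'; split => // s /dE[].
have Ft1 : 1 <= F t.
  have h : 1 <= F t `^ p^-1 by move: hL; rewrite /Lpnorm (pint_moment_norm cV r0 T0 sol p0 tT').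
  have -> : F t = (F t `^ p^-1) `^ p.
    by rewrite -powRrM mulVf ?gt_eqF// powRr1// ltW// F0.
  by have := le_powR p0 ler01 h; rewrite powR1.
have zT : 0 <= (0 : R) <= T by rewrite lexx/= ltW.
have Kvs : Kp V r p vs = K 0.
  rewrite /K /Kp; congr (_ * ln (fine _)); rewrite /pint /iint_on; congr iint.
  apply/funext => x; case: ifPn => // /asboolP bx.
  by have [_ [_ [_ [_ [ini _]]]]] := sol; rewrite ini// /cball/= ltW.
split => ht.
  rewrite Kvs !KE//; apply: (fast_decay p1 beta0 lam0 Fdec DF approx tpos tT Ft1).
  (* A time [s <= t] with [K s < 1] would give [t0 <= t]. *)
  move=> s /andP[s0 st]; rewrite leNgt; apply/negP => Ks.
  have sT : 0 <= s <= T by rewrite s0 (le_trans st).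
  have : (t0 <= s%:E)%E.
    by apply: ereal_inf_lbound; exists s => //=; split => //; rewrite KE// ltW.
  by rewrite leNgt (le_lt_trans _ ht)// lee_fin.
have t0_ge0 : (0 <= t0)%E.
  by apply: le_ereal_inf_tmp => _ [s [/andP[s0 _] _] <-]; rewrite lee_fin.
(* If [K] never reaches 1 on [[0, T]], the infimum is that of the empty set, [+oo]; here [t0 <= t]
   excludes this. *)
have t0_fin : t0 \is a fin_num.
  by rewrite ge0_fin_numE// (le_lt_trans ht)// ltry.
pose tau := fine t0.
have tauE : t0 = tau%:E by rewrite /tau fineK.
have tau0 : 0 <= tau by rewrite -lee_fin -tauE.
have taut : tau <= t by rewrite -lee_fin -tauE.
have tauT : 0 <= tau <= T by rewrite tau0 (le_trans taut).
(* The infimum is attained: [K tau > 1] would persist near [tau] by continuity, while times with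
   [K <= 1] accumulate at [tau] from the right. *)
have Ktau : K tau <= 1.
  rewrite leNgt; apply/negP => Kgt.
  have cK : continuous_at tau (fun s => (p - 1)^-1 * ln (F s)).
    apply: contM; first exact: cont_cst.
    apply: (@cont_comp R R R F (@ln R) tau); first exact: (moment_cont cV r0 T0 sol p0).
    by apply: continuous_ln; exact: F0.
  rewrite KE// in Kgt.
  have /nbhs_ballP[z /= z0 hz] := cont_near_gt cK Kgt.
  have : (t0 < (tau + z)%:E)%E by rewrite tauE lte_fin ltrDl.
  move=> /ereal_inf_lt[_ [s [sT Ks] <-]]; rewrite lte_fin => sz.
  have tau_s : tau <= s.
    by rewrite -lee_fin -tauE; apply: ereal_inf_lbound; exists s.
  have : 1 < (p - 1)^-1 * ln (F s).
    by apply: hz; rewrite /ball/= distrC ger0_norm ?subr_ge0// ltrBlDl.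
  by rewrite -KE// ltNge Ks.
rewrite -/tau !KE//; apply: (slow_decay p1 beta0 lam0 Fdec DF approx tau0 taut tT Ft1).
by rewrite -KE.
Qed.
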